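(* Let $\mathbf{k}$ be an algebraically closed field of characteristic zero. Let $\Delta_1$ be the simplicial complex on $[5]$ with facets $\{1,2\},\{2,3\},\{3,4\},\{4,5\}$, and let $\Delta_2$ be the simplicial complex on $[5]$ with facets $\{1,2\},\{2,4\},\{4,5\},\{3\}$. For parameters $t\in(\mathbf k^\times)^5$ and $h,g\in\mathbf k[x]$, and for $\Delta\in\{\Delta_1,\Delta_2\}$, the formulas $$\varphi_{t,h,g}:\quad \overline{x}_1\mapsto t_1\overline{x}_1,\quad \overline{x}_2\mapsto t_2\overline{x}_2+\overline{x}_1h(\overline{x}_1),\quad \overline{x}_3\mapsto t_3\overline{x}_3,\quad \overline{x}_4\mapsto t_4\overline{x}_4+\overline{x}_5g(\overline{x}_5),\quad \overline{x}_5\mapsto t_5\overline{x}_5$$ define automorphisms of $\mathbf k[\Delta]$, and, with $\tau$ the automorphism of $\mathbf k[\Delta]$ given by $\overline x_i\mapsto\overline x_{\pi(i)}$ for the permutation $\pi=(1\,5)(2\,4)$, $$\operatorname{Aut}(X_{\Delta_1})=\{\varphi_{t,h,g}\}\rtimes\langle\tau\rangle\qquad\text{and}\qquad \operatorname{Aut}(X_{\Delta_2})=\{\varphi_{t,h,g}\}\rtimes\langle\tau\rangle,$$ given by the same formulas. In particular $\operatorname{Aut}(X_{\Delta_1})$ and $\operatorname{Aut}(X_{\Delta_2})$ are isomorphic as ind-groups, while $X_{\Delta_1}\not\cong X_{\Delta_2}$. Consequently, in the statement ''if $\Delta,\Delta'$ are fully exposed simplicial complexes and $\operatorname{Aut}(X_\Delta)\cong\operatorname{Aut}(X_{\Delta'})$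 as ind-groups, then $\Delta\cong\Delta'$ and $X_\Delta\cong X_{\Delta'}$'', the fully exposed hypothesis cannot be removed.
   Context: $\mathbf{k}$ is an algebraically closed field of characteristic zero. A simplicial complex $\Delta$ on $[n]=\{1,\dots,n\}$ is a collection of subsets of $[n]$ (faces) closed under taking subsets, with $\{i\}\in\Delta$ for every $i\in[n]$; facets are the inclusion-maximal faces. A facet $F$ is exposed if there exist $i\in[n]$ and a face $S\subseteq F$ with $i\notin S$ such that every facet containing $S$ contains $i$; $\Delta$ is fully exposed if every facet is exposed. Stanley-Reisner variety: $\mathbf k[\Delta]=\mathbf k[x_1,\dots,x_n]/I_\Delta$ with $I_\Delta=(\prod_{i\in\sigma}x_i:\sigma\subseteq[n],\sigma\notin\Delta)$, $X_\Delta=\operatorname{Spec}\mathbf k[\Delta]$, $\overline{x}_i$ the class of $x_i$. $\operatorname{Aut}(X_\Delta)$ denotes $\operatorname{Aut}_{\mathbf k}(\mathbf k[\Delta])$. Ind-varieties and ind-groups: an ind-variety is a set $\mathcal V$ with an ascending filtration $\mathcal V_0\subseteq\mathcal V_1\subseteq\cdots$ with union $\mathcal V$, each $\mathcal V_k$ an algebraic variety (not necessarily irreducible) and each inclusion a closed immersion. A morphism $\varphi:\mathcal V\to\mathcal W$ is a map such that for each $k$ there is $\ell$ with $\varphi(\mathcal V_k)\subseteq\mathcal W_\ell$ and $\varphi|_{\mathcal V_k}$ a morphism of varieties. An ind-group is a group with an ind-variety structure for which multiplication and inversion are morphisms. An isomorphism of ind-groups is a group isomorphism that is also an isomorphism of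 ind-varieties. $\operatorname{Aut}(X_\Delta)$ is an ind-group: $\varphi$ is identified with $(\varphi,\varphi^{-1})$, each endomorphism being given by the tuple of images of $\overline x_1,\dots,\overline x_n$, and the $d$-th filtration piece consists of pairs for which $\varphi$ and $\varphi^{-1}$ both send every $\overline{x}_l$ to an element of total degree at most $d$. *)

(* Defs.v *)
From HB Require Import structures.
From mathcomp Require Import all_boot fingroup perm.
From mathcomp Require Import all_order all_algebra generic_quotient ring_quotient.
From mathcomp Require Import boolp classical_sets.
From mathcomp Require Import mpoly.

Set Implicit Arguments.
Unset Strict Implicit.
Unset Printing Implicit Defensive.

Import GRing.Theory.
Local Open Scope ring_scope.

(* Varieties are rendered as spaces with functions: a subset [supp] of an
   ambient type, a topology on it, and for every open set an algebra of
   [k]-valued functions, subject to the sheaf conditions.  Functions are total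
   on the ambient type, and only their values on the open set matter. *)

Record kspace (k : fieldType) (T : Type) := KSpace {
  supp : set T;
  opens : set (set T);
  regular : set T -> set (T -> k);
  opens_sub : forall U, opens U -> (U `<=` supp)%classic;
  opens_supp : opens supp;
  opensI : forall U V, opens U -> opens V -> opens (U `&` V)%classic;
  opens_bigcup : forall F : set (set T),
    (F `<=` opens)%classic -> opens (\bigcup_(U in F) U)%classic;
  regular_ext : forall U f g, opens U ->
    (forall x, U x -> f x = g x) -> regular U f -> regular U g;
  regular_restrict : forall U V f, opens U -> opens V -> (V `<=` U)%classic ->
    regular U f -> regular V f;
  regular_glue : forall (F : set (set T)) f, (F `<=` opens)%classic ->
    (forall U, F U -> regular U f) -> regular (\bigcup_(U in F) U)%classic f;
  regular_cst : forall U a, opens U -> regular U (fun=> a);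
  regularD : forall U f g, opens U -> regular U f -> regular U g ->
    regular U (fun x => f x + g x);
  regularM : forall U f g, opens U -> regular U f -> regular U g ->
    regular U (fun x => f x * g x);
  regularV : forall U f, opens U -> regular U f ->
    opens (U `&` [set x | f x != 0])%classic /\
    regular (U `&` [set x | f x != 0])%classic (fun x => (f x)^-1)
}.

(* A family of algebras of functions [P U], over a family [B] of subsets of [S]
   closed under intersections, generates a space with functions: the sets where
   some member of [P U] does not vanish form a basis, and the regular functions
   are those that are locally fractions of members of [P U]. *)

Definition gen_open (k : fieldType) (T : Type) (S : set T) (B : set (set T))
    (P : set T -> set (T -> k)) : set (set T) :=
  [set W | (W `<=` S)%classic /\
     forall x, W x -> exists U h, [/\ B U, P U h, U x, h x != 0 &
       forall y, U y -> h y != 0 -> W y]]%classic.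

Definition gen_regular (k : fieldType) (T : Type) (B : set (set T))
    (P : set T -> set (T -> k)) (W : set T) : set (T -> k) :=
  [set f | forall x, W x -> exists U g h, [/\ B U, P U g, P U h, U x & h x != 0 /\
       forall y, W y -> U y -> h y != 0 -> f y = g y / h y]]%classic.

Section Generated.
Local Open Scope classical_set_scope.
Variables (k : fieldType) (T : Type) (S : set T) (B : set (set T)).
Variable P : set T -> set (T -> k).
Hypothesis BS : B S.
Hypothesis BI : forall U V, B U -> B V -> B (U `&` V).
Hypothesis Pres : forall U V f, B U -> B V -> V `<=` U -> P U f -> P V f.
Hypothesis Pcst : forall U a, B U -> P U (fun=> a).
Hypothesis PD : forall U f g, B U -> P U f -> P U g -> P U (fun x => f x + g x).
Hypothesis PM : forall U f g, B U -> P U f -> P U g -> P U (fun x => f x * g x).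

Local Notation op := (gen_open S B P).
Local Notation rg := (gen_regular B P).

Fact gen_sub U : op U -> U `<=` S. Proof. by case. Qed.

Fact gen_supp : op S.
Proof.
by split=> // x Sx; exists S, (fun=> 1); split; rewrite ?oner_neq0 //; apply: Pcst.
Qed.

Fact gen_I U V : op U -> op V -> op (U `&` V).
Proof.
move=> [US Uo] [VS Vo]; split=> [x [/US//]|x [Ux Vx]].
have [U' [f [BU Pf U'x fx fU]]] := Uo x Ux.
have [V' [g [BV Pg V'x gx gV]]] := Vo x Vx.
have BUV := BI BU BV.
exists (U' `&` V'), (fun x => f x * g x); split=> //; first last.
- by move=> y [Uy Vy]; rewrite mulf_eq0 negb_or => /andP[fy gy]; split; auto.
- by rewrite mulf_neq0.
- by apply: PM => //; [apply: Pres Pf | apply: Pres Pg] => // y [].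
Qed.

Fact gen_bigcup (F : set (set T)) : F `<=` op -> op (\bigcup_(U in F) U).
Proof.
move=> Fo; split=> [x [U /Fo[US _] /US//]|x [U FU Ux]].
have [_ /(_ x Ux)[U' [h [BU Ph U'x hx hU]]]] := Fo U FU.
by exists U', h; split=> // y Uy hy; exists U => //; apply: hU.
Qed.

Fact gen_ext U (f g : T -> k) : op U ->
  (forall x, U x -> f x = g x) -> rg U f -> rg U g.
Proof.
move=> _ fg rf x Ux; have [V [a [b [BV Pa Pb Vx [bx ab]]]]] := rf x Ux.
by exists V, a, b; split=> //; split=> // y Uy Vy by_; rewrite -fg // ab.
Qed.

Fact gen_restrict U V (f : T -> k) : op U -> op V -> V `<=` U -> rg U f -> rg V f.
Proof.
move=> _ _ VU rf x /VU Ux; have [W [a [b [BV Pa Pb Wx [bx ab]]]]] := rf x Ux.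
by exists W, a, b; split=> //; split=> // y /VU; apply: ab.
Qed.

Fact gen_glue (F : set (set T)) (f : T -> k) : F `<=` op ->
  (forall U, F U -> rg U f) -> rg (\bigcup_(U in F) U) f.
Proof.
move=> Fo Ff x [U FU Ux].
have [W [a [b [BW Pa Pb Wx [bx ab]]]]] := Ff U FU x Ux.
have [_ /(_ x Ux)[V [h [BV Ph Vx hx hU]]]] := Fo U FU.
have BVW := BI BV BW.
have VP g : P V g -> P (V `&` W) g by apply: Pres => // y [].
have WP g : P W g -> P (V `&` W) g by apply: Pres => // y [].
exists (V `&` W), (fun x => a x * h x), (fun x => b x * h x); split=> //.
- by apply: PM => //; [apply: WP|apply: VP].
- by apply: PM => //; [apply: WP|apply: VP].
split=> [|y _ [Vy Wy]]; first by rewrite mulf_neq0.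
rewrite mulf_eq0 negb_or => /andP[by_ hy].
by rewrite -mulf_div divff // mulr1 ab //; apply: hU.
Qed.

Fact gen_cst U a : op U -> rg U (fun=> a).
Proof.
move=> [US _] x /US Sx; exists S, (fun=> a), (fun=> 1).
by split; rewrite ?oner_neq0 //; auto; split=> // *; rewrite divr1.
Qed.

Fact gen_pair U (f g : T -> k) x : rg U f -> rg U g -> U x ->
  exists V a b c d, [/\ B V, V x, P V a /\ P V b, P V c /\ P V d &
    [/\ b x != 0, d x != 0,
        forall y, U y -> V y -> b y != 0 -> f y = a y / b y &
        forall y, U y -> V y -> d y != 0 -> g y = c y / d y]].
Proof.
move=> rf rg_ Ux.
have [W [a [b [BW Pa Pb Wx [bx ab]]]]] := rf x Ux.
have [V [c [d [BV Pc Pd Vx [dx cd]]]]] := rg_ x Ux.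
have BVW := BI BV BW.
have VP h : P V h -> P (V `&` W) h by apply: Pres => // y [].
have WP h : P W h -> P (V `&` W) h by apply: Pres => // y [].
exists (V `&` W), a, b, c, d; split=> //; try by split; auto.
by split=> // [y Uy [Vy Wy]|y Uy [Vy Wy]]; auto.
Qed.

Fact gen_D U (f g : T -> k) : op U -> rg U f -> rg U g ->
  rg U (fun x => f x + g x).
Proof.
move=> _ rf rg_ x Ux.
have [V [a [b [c [d [BV Vx [Pa Pb] [Pc Pd] [bx dx ab cd]]]]]]] := gen_pair rf rg_ Ux.
exists V, (fun x => a x * d x + c x * b x), (fun x => b x * d x); split; auto.
split=> [|y Uy Vy]; first by rewrite mulf_neq0.
rewrite mulf_eq0 negb_or => /andP[by_ dy].
by rewrite ab // cd // addf_div.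
Qed.

Fact gen_M U (f g : T -> k) : op U -> rg U f -> rg U g ->
  rg U (fun x => f x * g x).
Proof.
move=> _ rf rg_ x Ux.
have [V [a [b [c [d [BV Vx [Pa Pb] [Pc Pd] [bx dx ab cd]]]]]]] := gen_pair rf rg_ Ux.
exists V, (fun x => a x * c x), (fun x => b x * d x); split; auto.
split=> [|y Uy Vy]; first by rewrite mulf_neq0.
rewrite mulf_eq0 negb_or => /andP[by_ dy].
by rewrite ab // cd // mulf_div.
Qed.

Fact gen_V U (f : T -> k) : op U -> rg U f ->
  op (U `&` [set x | f x != 0]) /\
  rg (U `&` [set x | f x != 0]) (fun x => (f x)^-1).
Proof.
move=> [US Uo] rf; split; last first.
  move=> x [Ux /= fx]; have [W [a [b [BW Pa Pb Wx [bx ab]]]]] := rf x Ux.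
  exists W, (fun x => b x * b x), (fun x => a x * b x); split; auto.
  split=> [|y [Uy /= fy] Wy].
    rewrite mulf_neq0 //; apply: contraNneq fx => a0.
    by rewrite ab // a0 mul0r.
  rewrite mulf_eq0 negb_or => /andP[ay by_].
  by rewrite ab // invf_div -mulf_div divff // mulr1.
split=> [x [/US]//|x [Ux /= fx]].
have [W [a [b [BW Pa Pb Wx [bx ab]]]]] := rf x Ux.
have [V [h [BV Ph Vx hx hU]]] := Uo x Ux.
have BVW := BI BV BW.
have VP g : P V g -> P (V `&` W) g by apply: Pres => // y [].
have WP g : P W g -> P (V `&` W) g by apply: Pres => // y [].
have ax : a x != 0 by apply: contraNneq fx => a0; rewrite ab // a0 mul0r.
exists (V `&` W), (fun x => h x * (a x * b x)); split=> //.
- by do !apply: PM => //; auto.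
- by rewrite !mulf_neq0.
move=> y [Vy Wy]; rewrite !mulf_eq0 !negb_or => /and3P[hy ay by_].
have Uy := hU y Vy hy.
by split=> //=; rewrite ab // mulf_neq0 // invr_neq0.
Qed.

Definition gen_space : kspace k T :=
  KSpace gen_sub gen_supp gen_I gen_bigcup gen_ext gen_restrict gen_glue
    gen_cst gen_D gen_M gen_V.

End Generated.

(* The Zariski structure that a subset [A] inherits from the affine space [k^m]
   through coordinate functions [c]. *)

Definition coord_fun (k : fieldType) (T : Type) (m : nat) (c : T -> 'I_m -> k) :
    set (T -> k) :=
  [set f | exists p : {mpoly k[m]}, f = (fun x => p.@[c x])]%classic.

Section Zariski.
Local Open Scope classical_set_scope.
Variables (k : fieldType) (T : Type) (m : nat) (A : set T) (c : T -> 'I_m -> k).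

Local Notation B := ([set A] : set (set T)).
Local Notation P := (fun _ : set T => coord_fun c).

Fact zariski_I (U V : set T) : B U -> B V -> B (U `&` V).
Proof. by move=> -> ->; rewrite setIid. Qed.

Fact zariski_res (U V : set T) f : B U -> B V -> V `<=` U -> P U f -> P V f.
Proof. by []. Qed.

Fact zariski_cst (U : set T) a : B U -> P U (fun=> a).
Proof. by move=> _; exists a%:MP; apply/funext => x; rewrite mevalC. Qed.

Fact zariski_D (U : set T) f g : B U -> P U f -> P U g -> P U (fun x => f x + g x).
Proof.
by move=> _ [p ->] [q ->]; exists (p + q); apply/funext => x; rewrite mevalD.
Qed.

Fact zariski_M (U : set T) f g : B U -> P U f -> P U g -> P U (fun x => f x * g x).
Proof.
by move=> _ [p ->] [q ->]; exists (p * q); apply/funext => x; rewrite mevalM.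
Qed.

Definition zariski : kspace k T :=
  gen_space (erefl : B A) zariski_I zariski_res
    zariski_cst zariski_D zariski_M.

End Zariski.

(* The product of spaces with functions is generated, over the products of open
   sets, by the finite sums of products of regular functions. *)

Definition tensor_fun (k : fieldType) (T T' : Type) (X : kspace k T)
    (Y : kspace k T') (W : set (T * T')) : set (T * T' -> k) :=
  [set f | exists U V r (a : 'I_r -> T -> k) (b : 'I_r -> T' -> k),
    [/\ [/\ opens X U, opens Y V & W = U `*` V],
        forall i, regular X U (a i), forall i, regular Y V (b i) &
        f = (fun z => \sum_(i < r) a i z.1 * b i z.2)]]%classic.

Section Product.
Local Open Scope classical_set_scope.
Variables (k : fieldType) (T T' : Type) (X : kspace k T) (Y : kspace k T').

Definition prod_base : set (set (T * T')) :=
  [set W | exists U V, [/\ opens X U, opens Y V & W = U `*` V]].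

Local Notation B := prod_base.
Local Notation P := (tensor_fun X Y).
Local Notation S := (supp X `*` supp Y).

Fact prod_S : B S.
Proof. by exists (supp X), (supp Y); split=> //; apply: opens_supp. Qed.

Fact prod_I W W' : B W -> B W' -> B (W `&` W').
Proof.
move=> [U [V [Uo Vo ->]]] [U' [V' [Uo' Vo' ->]]].
by exists (U `&` U'), (V `&` V'); rewrite setXI; split=> //; apply: opensI.
Qed.

Fact prod_res W W' f : B W -> B W' -> W' `<=` W -> P W f -> P W' f.
Proof.
move=> _ [U' [V' [Uo' Vo' W'E]]] WW' [U [V [r [a [b [[Uo Vo WE] ra rb ->]]]]]].
have UUo := opensI Uo Uo'; have VVo := opensI Vo Vo'.
exists (U `&` U'), (V `&` V'), r, a, b; split=> // [|i|i].
- by split=> //; rewrite setXI -WE -W'E setIidr.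
- exact: regular_restrict (ra i).
- exact: regular_restrict (rb i).
Qed.

Fact prod_cst W a : B W -> P W (fun=> a).
Proof.
move=> [U [V [Uo Vo WE]]]; exists U, V, 1, (fun _ _ => a), (fun _ _ => 1).
split=> // [i|i|]; [exact: regular_cst|exact: regular_cst|].
by apply/funext => z; rewrite big_ord1 mulr1.
Qed.

Fact split_regular (r r' : nat) (Z : Type) (V : kspace k Z) U
    (a : 'I_r -> Z -> k) (b : 'I_r' -> Z -> k) (i : 'I_(r + r')) :
  (forall i, regular V U (a i)) -> (forall i, regular V U (b i)) ->
  regular V U (match split i with inl j => a j | inr j => b j end).
Proof. by move=> ra rb; case: split. Qed.

Fact tensor_common W f g : P W f -> P W g -> exists U V, [/\ opens X U, opens Y V & W = U `*` V] /\
  (exists r (a : 'I_r -> T -> k) (b : 'I_r -> T' -> k),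
   [/\ forall i, regular X U (a i), forall i, regular Y V (b i) &
        f = (fun z => \sum_(i < r) a i z.1 * b i z.2)]) /\
  (exists r (a : 'I_r -> T -> k) (b : 'I_r -> T' -> k),
   [/\ forall i, regular X U (a i), forall i, regular Y V (b i) &
        g = (fun z => \sum_(i < r) a i z.1 * b i z.2)]).
Proof.
move=> [U [V [r [a [b [[Uo Vo WE] ra rb ->]]]]]].
move=> [U' [V' [r' [a' [b' [[Uo' Vo' W'E] ra' rb' ->]]]]]].
have UUo := opensI Uo Uo'; have VVo := opensI Vo Vo'.
exists (U `&` U'), (V `&` V'); split.
  by split=> //; rewrite setXI -WE -W'E setIid.
split.
  by exists r, a, b; split=> // i; [apply: regular_restrict (ra i)|
    apply: regular_restrict (rb i)].
by exists r', a', b'; split=> // i; [apply: regular_restrict (ra' i)|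
    apply: regular_restrict (rb' i)].
Qed.

Fact prod_D W f g : B W -> P W f -> P W g -> P W (fun x => f x + g x).
Proof.
move=> _ /tensor_common/[apply] [[U [V [UVW [[r [a [b [ra rb ->]]]]]]]]].
move=> [r' [a' [b' [ra' rb' ->]]]].
exists U, V, (r + r')%N,
  (fun i => match split i with inl j => a j | inr j => a' j end),
  (fun i => match split i with inl j => b j | inr j => b' j end).
split=> // [i|i|]; try exact: split_regular.
apply/funext => z; rewrite big_split_ord /=.
by congr (_ + _); apply: eq_bigr => i _; rewrite ?(unsplitK (inl i)) ?(unsplitK (inr i)).
Qed.

Fact prod_M W f g : B W -> P W f -> P W g -> P W (fun x => f x * g x).
Proof.
move=> _ /tensor_common/[apply] [[U [V [[Uo Vo WE] [[r [a [b [ra rb ->]]]]]]]]].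
move=> [r' [a' [b' [ra' rb' ->]]]].
pose I := ('I_r * 'I_r')%type.
exists U, V, #|{: I}|,
  (fun i x => a (enum_val i).1 x * a' (enum_val i).2 x),
  (fun i x => b (enum_val i).1 x * b' (enum_val i).2 x).
split=> // [i|i|]; try exact: regularM.
apply/funext => z; rewrite big_distrlr pair_big /=.
rewrite (reindex (enum_val : 'I_#|{: I}| -> I)) /=; last first.
  by apply: onW_bij; apply: enum_val_bij.
by apply: eq_bigr => i _; rewrite mulrACA.
Qed.

Definition prod_space : kspace k (T * T') :=
  gen_space prod_S prod_I prod_res prod_cst prod_D prod_M.

End Product.

(* Morphisms of spaces with functions; only the values of [f] on [supp X]
   matter. *)

Definition kmorphism (k : fieldType) (T T' : Type) (X : kspace k T)
    (Y : kspace k T') (f : T -> T') : Prop :=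
  (forall x, supp X x -> supp Y (f x)) /\
  forall W, opens Y W ->
    opens X (supp X `&` f @^-1` W)%classic /\
    forall h, regular Y W h ->
      regular X (supp X `&` f @^-1` W)%classic (fun x => h (f x)).

Definition closed_in (k : fieldType) (T : Type) (X : kspace k T) (Z : set T) : Prop :=
  (Z `<=` supp X)%classic /\ opens X (supp X `\` Z)%classic.

Definition closed_immersion (k : fieldType) (T T' : Type) (X : kspace k T)
    (Y : kspace k T') (f : T -> T') : Prop :=
  [/\ kmorphism X Y f,
      forall x y, supp X x -> supp X y -> f x = f y -> x = y,
      closed_in Y (f @` supp X)%classic,
      forall U, opens X U ->
        exists2 W, opens Y W & U = (supp X `&` f @^-1` W)%classic &
      forall U g x, opens X U -> regular X U g -> U x ->
        exists W h, [/\ opens Y W, regular Y W h, W (f x) &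
          forall y, U y -> W (f y) -> g y = h (f y)]].

Definition zariski_closed (k : fieldType) (m : nat) (Z : set ('I_m -> k)) : Prop :=
  exists S : set {mpoly k[m]}, Z = [set a | forall p, S p -> p.@[a] = 0]%classic.

(* [U] is affine: some coordinates identify the open subspace [U] of [X] with a
   Zariski closed subset of an affine space. *)
Definition affine_open (k : fieldType) (T : Type) (X : kspace k T) (U : set T) : Prop :=
  opens X U /\ exists m (c : T -> 'I_m -> k),
    [/\ forall x y, U x -> U y -> c x = c y -> x = y,
        zariski_closed (c @` U)%classic &
        forall W, (W `<=` U)%classic ->
          (opens X W <-> opens (zariski U c) W) /\
          (opens X W -> forall f, regular X W f <-> regular (zariski U c) W f)].

(* Algebraic varieties: covered by finitely many affine open subsets, and
   separated; neither irreducible nor nonempty in general. *)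
Definition variety (k : fieldType) (T : Type) (X : kspace k T) : Prop :=
  (exists r (U : 'I_r -> set T),
     (forall i, affine_open X (U i)) /\ supp X = (\bigcup_i U i)%classic) /\
  closed_in (prod_space X X) [set z | supp X z.1 /\ z.1 = z.2]%classic.

(* [f] is defined on the union of the pieces, which is all of [T] for an
   ind-variety on [T]. *)
Definition ind_morphism (k : fieldType) (T T' : Type) (V : nat -> kspace k T)
    (W : nat -> kspace k T') (f : T -> T') : Prop :=
  forall d, exists e, kmorphism (V d) (W e) f.

Record indVariety (k : fieldType) (T : Type) := IndVariety {
  piece : nat -> kspace k T;
  piece_variety : forall d, variety (piece d);
  piece_immersion : forall d, closed_immersion (piece d) (piece d.+1) id;
  piece_cover : forall x, exists d, supp (piece d) x
}.

Record indGroup (k : fieldType) := IndGroup {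
  ind_group :> groupType;
  ind_var : indVariety k ind_group;
  ind_mul : ind_morphism (fun d => prod_space (piece ind_var d) (piece ind_var d))
              (piece ind_var) (fun z => z.1 * z.2)%g;
  ind_inv : ind_morphism (piece ind_var) (piece ind_var) (fun x => x^-1)%g
}.

Definition indGroup_iso (k : fieldType) (G H : indGroup k) : Prop :=
  exists (f : G -> H) (g : H -> G),
    [/\ cancel f g, cancel g f, {morph f : x y / (x * y)%g},
        ind_morphism (piece (ind_var G)) (piece (ind_var H)) f &
        ind_morphism (piece (ind_var H)) (piece (ind_var G)) g].

(* [set0] is a face by the other two axioms unless [n = 0]. *)
Record complex (n : nat) := Complex {
  faces : {set {set 'I_n}};
  faces0 : finset.set0 \in faces;
  faces1 : forall i, [set i] \in faces;
  faces_sub : forall S S' : {set 'I_n}, S \subset S' -> S' \in faces -> S \in faces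
}.

Definition facet n (D : complex n) (F : {set 'I_n}) : bool :=
  (F \in faces D) &&
  [forall S : {set 'I_n}, (S \in faces D) ==> (F \subset S) ==> (S == F)].

Definition exposed n (D : complex n) (F : {set 'I_n}) : Prop :=
  facet D F /\ exists i (S : {set 'I_n}),
    [/\ S \in faces D, S \subset F, i \notin S &
        forall F', facet D F' -> S \subset F' -> i \in F'].

Definition fully_exposed n (D : complex n) : Prop :=
  forall F, facet D F -> exposed D F.

Definition complex_iso n n' (D : complex n) (D' : complex n') : Prop :=
  exists2 f : 'I_n -> 'I_n', bijective f &
    forall S : {set 'I_n}, (f @: S \in faces D') = (S \in faces D).

Section StanleyReisner.
Local Open Scope quotient_scope.
Variables (k : fieldType) (n : nat) (D : complex n).

Definition sr_ideal : pred {mpoly k[n]} := fun p =>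
  `[< exists a : {set 'I_n} -> {mpoly k[n]},
        p = \sum_(s | s \notin faces D) a s * \prod_(i in s) 'X_i >].

Fact sr_ideal_closed : idealr_closed sr_ideal.
Proof.
split.
- by apply/asboolP; exists (fun=> 0); rewrite big1 // => s _; rewrite mul0r.
- apply/asboolP => -[a /(congr1 (meval (fun=> 0)))] /eqP.
  rewrite meval1 raddf_sum big1 /= ?oner_eq0 // => s sD.
  have [s0|[i si]] := set_0Vmem s; first by rewrite s0 faces0 in sD.
  by rewrite mevalM rmorph_prod /= (bigD1 i) //= mevalXU mul0r mulr0.
move=> a u v /asboolP[b ->] /asboolP[c ->]; apply/asboolP.
exists (fun s => a * b s + c s); rewrite mulr_sumr -big_split.
by apply: eq_bigr => s _; rewrite mulrDl mulrA.
Qed.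

HB.instance Definition _ := isIdealr.Build {mpoly k[n]} sr_ideal sr_ideal_closed.

Definition sr_ring : Type := {ideal_quot (sr_ideal : idealr {mpoly k[n]})}.

HB.instance Definition _ := GRing.ComNzRing.on sr_ring.

Definition sr_pi (p : {mpoly k[n]}) : sr_ring := \pi_{ideal_quot (sr_ideal : idealr _)} p.

Fact sr_pi_is_zmod_morphism : zmod_morphism sr_pi.
Proof. exact: (raddfB (\pi_{ideal_quot (sr_ideal : idealr _)})). Qed.
HB.instance Definition _ :=
  GRing.isZmodMorphism.Build {mpoly k[n]} sr_ring sr_pi sr_pi_is_zmod_morphism.

Fact sr_pi_is_monoid_morphism : monoid_morphism sr_pi.
Proof. by split; [exact: (rmorph1 (\pi_{ideal_quot (sr_ideal : idealr _)}))|exact: (rmorphM (\pi_{ideal_quot (sr_ideal : idealr _)}))]. Qed.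
HB.instance Definition _ :=
  GRing.isMonoidMorphism.Build {mpoly k[n]} sr_ring sr_pi sr_pi_is_monoid_morphism.

Definition sr_scale (a : k) (f : sr_ring) : sr_ring := sr_pi a%:MP * f.

Fact sr_scaleA a b f : sr_scale a (sr_scale b f) = sr_scale (a * b) f.
Proof. by rewrite /sr_scale mulrA -rmorphM -mpolyCM. Qed.
Fact sr_scale1 : left_id 1 sr_scale.
Proof. by move=> f; rewrite /sr_scale mpolyC1 rmorph1 mul1r. Qed.
Fact sr_scaleDr : right_distributive sr_scale +%R.
Proof. by move=> a f g; rewrite /sr_scale mulrDr. Qed.
Fact sr_scaleDl f : {morph sr_scale^~ f : a b / a + b}.
Proof. by move=> a b; rewrite /sr_scale mpolyCD rmorphD mulrDl. Qed.
HB.instance Definition _ := GRing.Zmodule_isLmodule.Build k sr_ring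
  sr_scaleA sr_scale1 sr_scaleDr sr_scaleDl.

Fact sr_scaleAl (a : k) (f g : sr_ring) : a *: (f * g) = a *: f * g.
Proof. exact: mulrA. Qed.
HB.instance Definition _ := GRing.Lmodule_isLalgebra.Build k sr_ring sr_scaleAl.
Fact sr_scaleAr (a : k) (f g : sr_ring) : a *: (f * g) = f * (a *: g).
Proof. exact: mulrCA. Qed.
HB.instance Definition _ := GRing.Lalgebra_isAlgebra.Build k sr_ring sr_scaleAr.
HB.instance Definition _ := GRing.ComNzRing.on sr_ring.

Fact sr_pi_is_scalable : scalable sr_pi.
Proof. by move=> a p; rewrite -mul_mpolyC rmorphM. Qed.
HB.instance Definition _ :=
  GRing.isScalable.Build k {mpoly k[n]} sr_ring *:%R sr_pi sr_pi_is_scalable.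

Definition sr_var (i : 'I_n) : sr_ring := sr_pi 'X_i.

End StanleyReisner.


Section SpaceLemmas.
Local Open Scope classical_set_scope.
Variable k : fieldType.

Lemma opens_local (T : Type) (X : kspace k T) (W : set T) :
  (forall x, W x -> exists2 V, opens X V & V x /\ V `<=` W) -> opens X W.
Proof.
move=> loc; pose F := [set V | opens X V /\ V `<=` W].
suff -> : W = \bigcup_(V in F) V by apply: opens_bigcup => V [].
apply/seteqP; split=> [x /loc[V Vo [Vx VW]]|x [V [_ VW] /VW//]].
by exists V.
Qed.

Lemma regular_local (T : Type) (X : kspace k T) (W : set T) (f : T -> k) :
  (forall x, W x -> exists V, [/\ opens X V, V x, V `<=` W & regular X V f]) ->
  regular X W f.
Proof.
move=> loc; pose F := [set V | [/\ opens X V, V `<=` W & regular X V f]].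
suff -> : W = \bigcup_(V in F) V.
  by apply: regular_glue => V []. 
apply/seteqP; split=> [x /loc[V [Vo Vx VW rf]]|x [V [_ VW _] /VW//]].
by exists V.
Qed.

Lemma regular_meval (T : Type) (X : kspace k T) (U : set T) m
    (c : T -> 'I_m -> k) (p : {mpoly k[m]}) : opens X U ->
  (forall j, regular X U (fun x => c x j)) -> regular X U (fun x => p.@[c x]).
Proof.
move=> Uo rc; have -> : (fun x => p.@[c x]) =
    (fun x => \sum_(u <- msupp p) p@_u * \prod_i c x i ^+ u i).
  by apply/funext => x; rewrite mevalE.
elim: (msupp p) => [|u s IHs].
  have -> : (fun x : T => \sum_(u <- [::]) p@_u * \prod_i c x i ^+ u i) = (fun=> 0).
    by apply/funext => x; rewrite big_nil.
  exact: regular_cst.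
have -> : (fun x : T => \sum_(u <- u :: s) p@_u * \prod_i c x i ^+ u i) =
  (fun x => p@_u * \prod_i c x i ^+ u i + \sum_(u <- s) p@_u * \prod_i c x i ^+ u i).
  by apply/funext => x; rewrite big_cons.
apply: regularD => //; apply: regularM => //; first exact: regular_cst.
elim: (index_enum _) => [|i r IHr].
  have -> : (fun x : T => \prod_(i <- [::]) c x i ^+ u i) = (fun=> 1).
    by apply/funext => x; rewrite big_nil.
  exact: regular_cst.
have -> : (fun x : T => \prod_(i <- i :: r) c x i ^+ u i) =
  (fun x => c x i ^+ u i * \prod_(i <- r) c x i ^+ u i).
  by apply/funext => x; rewrite big_cons.
apply: regularM => //; elim: (u i) => [|e IHe]; first exact: regular_cst.
have -> : (fun x : T => c x i ^+ e.+1) = (fun x => c x i * c x i ^+ e).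
  by apply/funext => x; rewrite exprS.
exact: regularM.
Qed.

Lemma zariski_regular (T : Type) m (A : set T) (c : T -> 'I_m -> k) j :
  regular (zariski A c) A (fun x => c x j).
Proof.
move=> x Ax; exists A, (fun x => c x j), (fun=> 1); split=> //.
- by exists 'X_j; apply/funext => y; rewrite mevalXU.
- by exists 1; apply/funext => y; rewrite meval1.
by split; rewrite ?oner_eq0 // => *; rewrite divr1.
Qed.

Lemma to_zariski (T T' : Type) (X : kspace k T) m (A : set T') (c : T' -> 'I_m -> k)
    (f : T -> T') :
  (forall x, supp X x -> A (f x)) ->
  (forall j, regular X (supp X) (fun x => c (f x) j)) ->
  kmorphism X (zariski A c) f.
Proof.
move=> fA fc; split=> // W [WA Wo].
have So := opens_supp X.
have rp p : regular X (supp X) (fun x => p.@[c (f x)]) by apply: regular_meval.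
have fWo : opens X (supp X `&` f @^-1` W).
  apply: opens_local => x [Sx Wfx].
  have [_ [_ [-> [p ->] _ px pW]]] := Wo _ Wfx.
  exists (supp X `&` [set x | p.@[c (f x)] != 0]); last first.
    by split=> // y [Sy py]; split=> //; apply: pW => //; apply: fA.
  by have [] := regularV So (rp p).
split=> // h hr; apply: regular_local => x [Sx Wfx].
have [_ [_ [_ [-> [p ->] [q ->] _ [qx hpq]]]]] := hr _ Wfx.
have [Do Dr] := regularV So (rp q).
have No := opensI fWo Do.
exists ((supp X `&` f @^-1` W) `&` (supp X `&` [set x | q.@[c (f x)] != 0])).
split=> //.
apply: (@regular_ext _ _ _ _ (fun x => p.@[c (f x)] * (q.@[c (f x)])^-1)) => //.
  by move=> y [[Sy Wy] [_ qy]]; rewrite hpq //; apply: fA.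
apply: regularM => //; first by apply: regular_restrict (rp p) => // y [[]].
by apply: regular_restrict Dr => // y [].
Qed.

Lemma regular_fst (T T' : Type) (X : kspace k T) (Y : kspace k T') f :
  regular X (supp X) f ->
  regular (prod_space X Y) (supp X `*` supp Y) (fun z => f z.1).
Proof.
move=> fr; rewrite /=; move=> z Sz; exists (supp X `*` supp Y), (fun z => f z.1), (fun=> 1).
have So := opens_supp X; have So' := opens_supp Y.
split=> //; first by exists (supp X), (supp Y).
- exists (supp X), (supp Y), 1, (fun=> f), (fun _ _ => 1); split=> // [i|].
    exact: regular_cst.
  by apply/funext => u; rewrite big_ord1 mulr1.
- exists (supp X), (supp Y), 1, (fun _ _ => 1), (fun _ _ => 1).
  by split=> // [i|i|]; [exact: regular_cst| exact: regular_cst|];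
    apply/funext => u; rewrite big_ord1 mulr1.
by split; rewrite ?oner_eq0 // => *; rewrite divr1.
Qed.

Lemma regular_snd (T T' : Type) (X : kspace k T) (Y : kspace k T') f :
  regular Y (supp Y) f ->
  regular (prod_space X Y) (supp X `*` supp Y) (fun z => f z.2).
Proof.
move=> fr; rewrite /=; move=> z Sz; exists (supp X `*` supp Y), (fun z => f z.2), (fun=> 1).
have So := opens_supp X; have So' := opens_supp Y.
split=> //; first by exists (supp X), (supp Y).
- exists (supp X), (supp Y), 1, (fun _ _ => 1), (fun=> f); split=> // [i|].
    exact: regular_cst.
  by apply/funext => u; rewrite big_ord1 mul1r.
- exists (supp X), (supp Y), 1, (fun _ _ => 1), (fun _ _ => 1).
  by split=> // [i|i|]; [exact: regular_cst| exact: regular_cst|];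
    apply/funext => u; rewrite big_ord1 mulr1.
by split; rewrite ?oner_eq0 // => *; rewrite divr1.
Qed.

Lemma zariski_variety (T : Type) m (A : set T) (c : T -> 'I_m -> k) :
  (forall x y, A x -> A y -> c x = c y -> x = y) -> zariski_closed (c @` A) ->
  variety (zariski A c).
Proof.
move=> cI cA; split.
  exists 1%N, (fun=> A); split=> [_|].
    split; first exact: (opens_supp (zariski A c)).
    by exists m, c; split=> // W.
  by apply/seteqP; split=> [x Ax|x [? _]//]; exists ord0.
split=> [[x y] [/= Ax <-]//|].
apply: opens_local => -[x y] [[/= Ax Ay] xy].
have [j cj] : exists j, c x j - c y j != 0.
  apply/existsP; rewrite -[X in is_true X]negbK negb_exists; apply/negP => /forallP ce.
  by apply: xy; split=> //=; apply: cI => //; apply/funext => j;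
    apply/eqP; rewrite -subr_eq0 -[_ == _]negbK.
pose X := zariski A c.
have hr : regular (prod_space X X) (supp X `*` supp X)
    (fun z => c z.1 j + -1 * c z.2 j).
  have So := opens_supp (prod_space X X).
  apply: (@regularD _ _ (prod_space X X) _ (fun z => c z.1 j)) => //.
    by apply: (@regular_fst _ _ X X (fun x => c x j)); apply: zariski_regular.
  apply: (@regularM _ _ (prod_space X X) _ (fun=> -1)) => //.
    exact: regular_cst.
  by apply: (@regular_snd _ _ X X (fun x => c x j)); apply: zariski_regular.
have [Do _] := regularV (opens_supp (prod_space X X)) hr.
exists ((supp X `*` supp X) `&` [set z | c z.1 j + -1 * c z.2 j != 0]) => //.
split; first by rewrite /= mulN1r.
move=> [u v] [[/= Au Av] /= uv]; split=> // -[_ /= uvE].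
by move: uv; rewrite uvE mulN1r subrr eqxx.
Qed.

Lemma zariski_open (T : Type) m (A : set T) (c : T -> 'I_m -> k) (p : {mpoly k[m]}) :
  opens (zariski A c) (A `&` [set x | p.@[c x] != 0]).
Proof.
have rp : regular (zariski A c) A (fun x => p.@[c x]).
  apply: regular_meval; first exact: (opens_supp (zariski A c)).
  exact: zariski_regular.
by have [] := regularV (opens_supp (zariski A c)) rp.
Qed.

Lemma zariski_immersion (T : Type) m m' (A A' : set T) (c : T -> 'I_m -> k)
    (c' : T -> 'I_m' -> k) (P : 'I_m -> {mpoly k[m']}) (P' : 'I_m' -> {mpoly k[m]})
    (S : set {mpoly k[m']}) :
  (forall x j, A x -> c x j = (P j).@[c' x]) ->
  (forall x j, A x -> c' x j = (P' j).@[c x]) ->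
  A = A' `&` [set x | forall p, S p -> p.@[c' x] = 0] ->
  closed_immersion (zariski A c) (zariski A' c') id.
Proof.
move=> cP c'P' AE.
have AA' : A `<=` A' by rewrite AE => x [].
have Ao := opens_supp (zariski A c); have Ao' := opens_supp (zariski A' c').
pose lft (p : {mpoly k[m]}) : {mpoly k[m']} := p \mPo [tuple P j | j < m].
have lftE p x : A x -> (lft p).@[c' x] = p.@[c x].
  move=> Ax; rewrite /lft comp_mpoly_meval; apply: mpoly.meval_eq => j.
  by rewrite tnth_mktuple cP.
have W_of U : opens (zariski A c) U -> exists2 W, opens (zariski A' c') W & U = A `&` W.
  move=> [UA Uo].
  pose W := [set y | A' y /\ exists2 p : {mpoly k[m']}, p.@[c' y] != 0 &
               forall z, A z -> p.@[c' z] != 0 -> U z].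
  exists W.
    apply: opens_local => y [A'y [p py pU]].
    exists (A' `&` [set x | p.@[c' x] != 0]); first exact: zariski_open.
    by split=> // z [A'z pz]; split=> //; exists p.
  apply/seteqP; split=> [x Ux|x [Ax [_ [p px /(_ x Ax px)]]]//].
  split; first exact: UA.
  split; first exact/AA'/UA.
  have [_ [_ [-> [p ->] Ax px pU]]] := Uo x Ux.
  by exists (lft p) => [|z Az]; rewrite lftE //; apply: pU.
split=> //.
- apply: to_zariski => // j.
  apply: (@regular_ext _ _ _ _ (fun x => (P' j).@[c x])) => // [x Ax|].
    by rewrite -c'P'.
  by apply: regular_meval => // i; apply: zariski_regular.
- rewrite image_id; split=> //.
  apply: opens_local => x [A'x nAx].
  have [p [Sp px]] : exists p, S p /\ p.@[c' x] != 0.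
    apply: contrapT => H; apply: nAx; rewrite AE; split=> // p Sp.
    by apply: contrapT => /eqP px; apply: H; exists p.
  exists (A' `&` [set x | p.@[c' x] != 0]); first exact: zariski_open.
  split=> // y [A'y py]; split=> // ; rewrite AE => -[_ /(_ p Sp) p0].
  by rewrite /= p0 eqxx in py.
move=> U g x Uo gr Ux; have [W Wo UW] := W_of U Uo.
have [_ [_ [_ [-> [p ->] [q ->] Ax [qx hpq]]]]] := gr x Ux.
have rl p' : regular (zariski A' c') A' (fun x => p'.@[c' x]).
  by apply: regular_meval => // j; apply: zariski_regular.
have [Do Dr] := regularV Ao' (rl (lft q)).
exists (W `&` (A' `&` [set x | (lft q).@[c' x] != 0])).
exists (fun x => (lft p).@[c' x] * ((lft q).@[c' x])^-1); split.
- exact: opensI.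
- have WDo := opensI Wo Do.
  apply: regularM => //; first by apply: regular_restrict (rl _) => // y [_ []].
  by apply: regular_restrict Dr => // y [].
- by split; [move: Ux; rewrite UW => -[]|split; [exact: AA'|rewrite /= lftE]].
move=> y Uy [_ [_ /= qy]].
have Ay : A y by move: Uy; rewrite UW => -[].
by rewrite !lftE // hpq // -lftE.
Qed.

End SpaceLemmas.

Record alg_aut (k : fieldType) (A : comAlgType k) := AlgAut {
  aut_fun :> A -> A;
  aut_inv : A -> A;
  aut_funK : cancel aut_fun aut_inv;
  aut_invK : cancel aut_inv aut_fun;
  aut_linear : linear aut_fun;
  aut_monoid : monoid_morphism aut_fun
}.

Section AutGroup.
Variables (k : fieldType) (A : comAlgType k).
Implicit Types s t : alg_aut A.

HB.instance Definition _ := gen_eqMixin (alg_aut A).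
HB.instance Definition _ := gen_choiceMixin (alg_aut A).

HB.instance Definition _ s := GRing.isLinear.Build k A A *:%R s (aut_linear s).
HB.instance Definition _ s := GRing.isMonoidMorphism.Build A A s (aut_monoid s).

Lemma aut_ext s t : s =1 t -> s = t.
Proof.
move=> st; case: s t st => [f f' fK f'K fl fm] [g g' gK g'K gl gm] /= /funext fg.
subst g; have f'g' : f' = g'.
  by apply/funext => x; apply: (can_inj fK); rewrite f'K g'K.
by subst g'; congr AlgAut; apply: Prop_irrelevance.
Qed.

Fact aut_inv_linear s : linear (aut_inv s).
Proof.
by move=> a x y; apply: (can_inj (aut_funK s)); rewrite linearP /= !aut_invK.
Qed.
Fact aut_inv_monoid s : monoid_morphism (aut_inv s).
Proof.
split=> [|x y]; apply: (can_inj (aut_funK s)).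
  by rewrite aut_invK rmorph1.
by rewrite rmorphM /= !aut_invK.
Qed.
Fact aut_mul_linear s t : linear (s \o t).
Proof. by move=> a x y; rewrite /= !linearP. Qed.
Fact aut_mul_monoid s t : monoid_morphism (s \o t).
Proof. by split=> [|x y] /=; rewrite ?rmorph1 // !rmorphM. Qed.

Definition aut_one : alg_aut A :=
  @AlgAut k A idfun idfun (fun=> erefl) (fun=> erefl) (fun _ _ _ => erefl)
    (erefl, fun _ _ => erefl).
Definition aut_mul s t : alg_aut A :=
  AlgAut (can_comp (aut_funK s) (aut_funK t)) (can_comp (aut_invK t) (aut_invK s))
    (aut_mul_linear s t) (aut_mul_monoid s t).
Definition aut_V s : alg_aut A :=
  AlgAut (aut_invK s) (aut_funK s) (aut_inv_linear s) (aut_inv_monoid s).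

Fact aut_mulA : associative aut_mul. Proof. by move=> s t u; apply: aut_ext. Qed.
Fact aut_mul1 : left_id aut_one aut_mul. Proof. by move=> s; apply: aut_ext. Qed.
Fact aut_1mul : right_id aut_one aut_mul. Proof. by move=> s; apply: aut_ext. Qed.
Fact aut_mulV : left_inverse aut_one aut_V aut_mul.
Proof. by move=> s; apply: aut_ext => x; apply: aut_funK. Qed.
Fact aut_Vmul : right_inverse aut_one aut_V aut_mul.
Proof. by move=> s; apply: aut_ext => x; apply: aut_invK. Qed.

HB.instance Definition _ :=
  isGroup.Build (alg_aut A) aut_mulA aut_mul1 aut_1mul aut_mulV aut_Vmul.

Lemma aut_mulE s t x : (s * t)%g x = s (t x). Proof. by []. Qed.
Lemma aut_1E x : (1%g : alg_aut A) x = x. Proof. by []. Qed.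

End AutGroup.

Section Coefficients.
Variables (k : fieldType) (n : nat) (D : complex n).
Local Notation R := (sr_ring k D).

(* Total degree at most [d]: that of some representative. *)
Definition sr_degree_le (d : nat) (f : R) : Prop :=
  exists2 p : {mpoly k[n]}, (msize p <= d.+1)%N & sr_pi D p = f.

(* The classes of the monomials supported on a face form a [k]-basis of
   [sr_ring k D], and [sr_coef m] is the coordinate along such a monomial: it
   does not depend on the representative [repr f] (lemma [sr_coef_pi]). *)
Definition face_mnm (m : 'X_{1..n}) : bool := [set i | m i != 0%N]%SET \in faces D.

Definition sr_coef (m : 'X_{1..n}) (f : R) : k :=
  if face_mnm m
  then (repr (f : {ideal_quot (sr_ideal D : idealr {mpoly k[n]})}) : {mpoly k[n]})@_m
  else 0.

Lemma face_mnm_le (m m' : 'X_{1..n}) : (forall i, m i <= m' i)%N ->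
  face_mnm m' -> face_mnm m.
Proof.
move=> le; apply: faces_sub; apply/fintype.subsetP => i; rewrite !inE -!lt0n.
by move=> mi; apply: leq_trans (le i).
Qed.

Lemma face_monoE (s : {set 'I_n}) :
  \prod_(i in s) 'X_i = 'X_[k, [multinom (i \in s : nat) | i < n]].
Proof.
rewrite [RHS]mpolyXE_id big_mkcond; apply: eq_bigr => i _.
by rewrite mnmE; case: (i \in s); rewrite ?expr1 ?expr0.
Qed.

Lemma ideal_coef (p : {mpoly k[n]}) m : p \in sr_ideal D -> face_mnm m -> p@_m = 0.
Proof.
move=> /asboolP[a ->] Fm; rewrite raddf_sum big1 // => s sD; rewrite /= face_monoE.
apply: memN_msupp_eq0; rewrite (perm_mem (msuppMX _ _)); apply/negP => /mapP[u _ mE].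
case/negP: sD; apply: (faces_sub _ Fm); apply/fintype.subsetP => i si.
by rewrite inE -lt0n mE mnmDE mnmE si.
Qed.

Lemma coef_ideal (p : {mpoly k[n]}) :
  (forall m, face_mnm m -> p@_m = 0) -> p \in sr_ideal D.
Proof.
move=> p0; rewrite (mpolyE p); apply: rpred_sum => m _.
have [Fm|nFm] := boolP (face_mnm m); first by rewrite p0 // scale0r rpred0.
rewrite -mul_mpolyC; apply: idealMr; apply/asboolP.
pose S := [set i | m i != 0%N]%SET.
exists (fun s => if s == S then 'X_[(m - [multinom (i \in S : nat) | i < n])%MM] else 0).
rewrite (bigD1 S) //= eqxx [X in _ + X]big1 ?addr0; last first.
  by move=> s /andP[_ /negPf ->]; rewrite mul0r.
rewrite face_monoE -mpolyXD submK //; apply/mnm_lepP => i.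
by rewrite mnmE inE; case: (m i).
Qed.

Lemma sr_piK (f : R) :
  sr_pi D (repr (f : {ideal_quot (sr_ideal D : idealr {mpoly k[n]})})) = f.
Proof. exact: reprK. Qed.

Lemma sr_pi_eq0 (p : {mpoly k[n]}) : (sr_pi D p == 0) = (p \in sr_ideal D).
Proof.
by rewrite -(raddf0 (sr_pi D)) -[p in RHS]subr0 Quotient.idealrBE.
Qed.

Lemma sr_coef_pi m (p : {mpoly k[n]}) :
  sr_coef m (sr_pi D p) = if face_mnm m then p@_m else 0.
Proof.
rewrite /sr_coef; case: ifP => // Fm; set q := repr _.
apply/eqP; rewrite -subr_eq0 -mcoeffB ideal_coef // -sr_pi_eq0 raddfB /= sr_piK.
by rewrite subrr.
Qed.

Lemma sr_coef_notface m f : ~~ face_mnm m -> sr_coef m f = 0.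
Proof. by rewrite /sr_coef => /negPf ->. Qed.

Lemma sr_coef_inj f g : (forall m, sr_coef m f = sr_coef m g) -> f = g.
Proof.
rewrite -(sr_piK f) -(sr_piK g); set p := repr _; set q := repr _ => pq.
apply/eqP; rewrite -subr_eq0 -raddfB sr_pi_eq0; apply: coef_ideal => m Fm.
by have := pq m; rewrite !sr_coef_pi Fm mcoeffB => ->; rewrite subrr.
Qed.

Lemma sr_coefD m f g : sr_coef m (f + g) = sr_coef m f + sr_coef m g.
Proof.
rewrite -(sr_piK f) -(sr_piK g) -raddfD !sr_coef_pi mcoeffD.
by case: ifP => // _; rewrite addr0.
Qed.

Lemma sr_coefZ m a f : sr_coef m (a *: f) = a * sr_coef m f.
Proof.
rewrite -(sr_piK f) -linearZ !sr_coef_pi mcoeffZ.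
by case: ifP => // _; rewrite mulr0.
Qed.

Lemma sr_coefM m f g : sr_coef m (f * g) = if face_mnm m then
  \sum_(u : 'X_{1..n < (mdeg m).+1, (mdeg m).+1} | m == (u.1 + u.2)%MM)
     sr_coef u.1 f * sr_coef u.2 g else 0.
Proof.
rewrite -(sr_piK f) -(sr_piK g) -rmorphM sr_coef_pi; case: ifP => // Fm.
rewrite mcoeffM; apply: eq_bigr => u /eqP mE; rewrite !sr_coef_pi.
have F1 : face_mnm u.1 by apply: face_mnm_le Fm => i; rewrite [leqRHS](congr1 (fun v : 'X_{1..n} => v i) mE) mnmDE leq_addr.
have F2 : face_mnm u.2 by apply: face_mnm_le Fm => i; rewrite [leqRHS](congr1 (fun v : 'X_{1..n} => v i) mE) mnmDE leq_addl.
by rewrite F1 F2.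
Qed.

Lemma sr_coef_sum m (I : Type) (r : seq I) (F : I -> R) :
  sr_coef m (\sum_(i <- r) F i) = \sum_(i <- r) sr_coef m (F i).
Proof.
elim: r => [|i r IHr]; last by rewrite !big_cons sr_coefD IHr.
by rewrite !big_nil -(raddf0 (sr_pi D)) sr_coef_pi mcoeff0 if_same.
Qed.

Lemma sr_degree_coef d f :
  sr_degree_le d f <-> (forall m, (d < mdeg m)%N -> sr_coef m f = 0).
Proof.
split=> [[p pd <-] m dm|f0].
  rewrite sr_coef_pi memN_msupp_eq0 ?if_same //; apply/negP => /msize_mdeg_lt.
  by move=> /(leq_trans)/(_ pd); rewrite ltnS leqNgt dm.
exists (\sum_(m : 'X_{1..n < d.+1}) sr_coef m f *: 'X_[m]).
  apply/(leq_trans (msize_sum _ _ _))/bigmax_leqP => m _.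
  apply: leq_trans (msizeZ_le _ _) _; rewrite msizeX; exact: bmdeg.
apply: sr_coef_inj => m; rewrite sr_coef_pi.
have [Fm|nFm] := boolP (face_mnm m); last by rewrite sr_coef_notface.
have [dm|dm] := ltnP d (mdeg m); last first.
  by rewrite (mcoeff_mpoly (fun m => sr_coef m f)).
rewrite f0 // raddf_sum big1 // => u _ /=; rewrite mcoeffZ mcoeffX.
case: eqP => [uE|]; last by rewrite mulr0.
by move: dm; rewrite -uE ltnNge -ltnS bmdeg.
Qed.

Lemma sr_expand d f : sr_degree_le d f ->
  f = \sum_(m : 'X_{1..n < d.+1}) sr_coef m f *: sr_pi D 'X_[m].
Proof.
move=> /sr_degree_coef f0.
have -> : \sum_(m : 'X_{1..n < d.+1}) sr_coef m f *: sr_pi D 'X_[m] =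
  sr_pi D (\sum_(m : 'X_{1..n < d.+1}) sr_coef m f *: 'X_[m]).
  by rewrite raddf_sum; apply: eq_bigr => m _; rewrite /= linearZ.
apply: sr_coef_inj => m; rewrite sr_coef_pi.
have [Fm|nFm] := boolP (face_mnm m); last by rewrite sr_coef_notface.
have [dm|dm] := ltnP d (mdeg m); last first.
  by rewrite (mcoeff_mpoly (fun m => sr_coef m f)).
rewrite f0 // raddf_sum big1 // => u _ /=; rewrite mcoeffZ mcoeffX.
case: eqP => [uE|]; last by rewrite mulr0.
by move: dm; rewrite -uE ltnNge -ltnS bmdeg.
Qed.

Lemma sr_degree_mono d e f : (d <= e)%N -> sr_degree_le d f -> sr_degree_le e f.
Proof. by move=> de [p pd <-]; exists p => //; apply: leq_trans pd _. Qed.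

Lemma sr_degreeM d e f g : sr_degree_le d f -> sr_degree_le e g ->
  sr_degree_le (d + e) (f * g).
Proof.
move=> /sr_degree_coef f0 /sr_degree_coef g0; apply/sr_degree_coef => m dm.
rewrite sr_coefM; case: ifP => // _; apply: big1 => u /eqP mE.
have [du|du] := ltnP d (mdeg u.1); first by rewrite f0 // mul0r.
rewrite [X in _ * X]g0 ?mulr0 //.
move: dm; rewrite [ltnRHS](congr1 mdeg mE) mdegD; move: (mdeg u.1) (mdeg u.2) du => a b ad.
rewrite !ltnNge; apply: contra => be; exact: leq_add.
Qed.
End Coefficients.

Section AutIndGroup.
Local Open Scope classical_set_scope.
Variables (k : fieldType) (n : nat) (D : complex n).
Local Notation R := (sr_ring k D).
Local Notation G := (alg_aut (sr_ring k D)).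
Local Notation x_ := (sr_var k D).

Definition aut_bounded (d : nat) : set G :=
  [set s : G | forall l, sr_degree_le d (s (x_ l)) /\ sr_degree_le d (aut_inv s (x_ l))].

(* The coordinates of [s]: the coefficients, up to degree [d], of the images of
   the variables by [s] (index [true]) and by its inverse (index [false]). *)
Definition coord_index (d : nat) : finType := (bool * 'I_n * 'X_{1..n < d.+1})%type.

Definition aut_pair (s : G) (b : bool) : R -> R := if b then aut_fun s else aut_inv s.

Definition aut_coord (d : nat) (s : G) (j : 'I_#|coord_index d|) : k :=
  let: (b, l, m) := enum_val j in sr_coef m (aut_pair s b (x_ l)).

Definition aut_piece (d : nat) : kspace k G := zariski (aut_bounded d) (@aut_coord d).

(* [R]-valued functions all of whose coefficients lie in an algebra [P] of
   [k]-valued functions. *)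
Section Good.
Variables (Z : Type) (P : set (Z -> k)).
Hypothesis Pcst : forall a, P (fun=> a).
Hypothesis PD : forall f g, P f -> P g -> P (fun z => f z + g z).
Hypothesis PM : forall f g, P f -> P g -> P (fun z => f z * g z).

Definition good (F : Z -> R) := forall m, P (fun z => sr_coef m (F z)).

Lemma P_sum (I : Type) (r : seq I) (C : pred I) (F : I -> Z -> k) :
  (forall i, P (F i)) -> P (fun z => \sum_(i <- r | C i) F i z).
Proof.
move=> PF; elim: r => [|i r IHr].
  by have -> : (fun z => \sum_(i <- [::] | C i) F i z) = (fun=> 0);
    [apply/funext => z; rewrite big_nil | exact: Pcst].
have -> : (fun z => \sum_(i <- i :: r | C i) F i z) =
  (fun z => (if C i then 1 else 0) * F i z + \sum_(i <- r | C i) F i z).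
  by apply/funext => z; rewrite big_cons; case: (C i); rewrite ?mul1r // mul0r add0r.
by apply: PD => //; apply: PM.
Qed.

Lemma good_ext F F' : F =1 F' -> good F -> good F'.
Proof. by move=> /funext ->. Qed.

Lemma good_cst f : good (fun=> f). Proof. by move=> m; apply: Pcst. Qed.

Lemma goodD F F' : good F -> good F' -> good (fun z => F z + F' z).
Proof.
move=> gF gF' m; have -> : (fun z => sr_coef m (F z + F' z)) =
  (fun z => sr_coef m (F z) + sr_coef m (F' z)) by apply/funext => z; rewrite sr_coefD.
exact: PD.
Qed.

Lemma goodZ a F : P a -> good F -> good (fun z => a z *: F z).
Proof.
move=> Pa gF m; have -> : (fun z => sr_coef m (a z *: F z)) =
  (fun z => a z * sr_coef m (F z)) by apply/funext => z; rewrite sr_coefZ.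
exact: PM.
Qed.

Lemma goodM F F' : good F -> good F' -> good (fun z => F z * F' z).
Proof.
move=> gF gF' m; have [Fm|nFm] := boolP (face_mnm D m); last first.
  have -> : (fun z => sr_coef m (F z * F' z)) = (fun=> 0); last exact: Pcst.
  by apply/funext => z; rewrite sr_coef_notface.
have -> : (fun z => sr_coef m (F z * F' z)) = (fun z =>
  \sum_(u : 'X_{1..n < (mdeg m).+1, (mdeg m).+1} | m == (u.1 + u.2)%MM)
     (sr_coef u.1 (F z) * sr_coef u.2 (F' z))).
  by apply/funext => z; rewrite sr_coefM Fm.
by apply: P_sum => u; apply: PM.
Qed.

Lemma good_sum (I : Type) (r : seq I) (F : I -> Z -> R) :
  (forall i, good (F i)) -> good (fun z => \sum_(i <- r) F i z).
Proof.
move=> gF; elim: r => [|i r IHr].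
  by apply: (@good_ext (fun=> 0)) => [z|]; [rewrite big_nil | apply: good_cst].
apply: (@good_ext (fun z => F i z + \sum_(i <- r) F i z)) => [z|].
  by rewrite big_cons.
exact: goodD.
Qed.

Lemma good_prod (I : Type) (r : seq I) (C : pred I) (F : I -> Z -> R) :
  (forall i, good (F i)) -> good (fun z => \prod_(i <- r | C i) F i z).
Proof.
move=> gF; elim: r => [|i r IHr].
  by apply: (@good_ext (fun=> 1)) => [z|]; [rewrite big_nil | apply: good_cst].
apply: (@good_ext (fun z => (if C i then F i z else 1) * \prod_(i <- r | C i) F i z)).
  by move=> z; rewrite big_cons; case: (C i); rewrite ?mul1r.
by apply: goodM => //; case: (C i) => //; apply: good_cst.
Qed.

Lemma good_exp F e : good F -> good (fun z => F z ^+ e).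
Proof.
move=> gF; elim: e => [|e IHe]; first exact: good_cst.
by apply: (@good_ext (fun z => F z * F z ^+ e)) => [z|]; rewrite ?exprS //; apply: goodM.
Qed.

Lemma good_mmap1 (h : Z -> 'I_n -> R) (m : 'X_{1..n}) :
  (forall i, good (fun z => h z i)) -> good (fun z => mmap1 (h z) m).
Proof. by move=> gh; apply: good_prod => i; apply: good_exp. Qed.

End Good.

Lemma aut_pi (s : G) (p : {mpoly k[n]}) :
  s (sr_pi D p) = mmap (in_alg R) (fun i => s (x_ i)) p.
Proof.
rewrite {1}(mpolyE p) !raddf_sum /mmap; apply: eq_bigr => m _.
rewrite /= !linearZ /= mulr_algl; congr (_ *: _).
rewrite mpolyXE_id !rmorph_prod; apply: eq_bigr => i _ /=.
by rewrite !rmorphXn.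
Qed.

Lemma aut_mono (s : G) (m : 'X_{1..n}) :
  s (sr_pi D 'X_[m]) = mmap1 (fun i => s (x_ i)) m.
Proof. by rewrite aut_pi mmapX. Qed.

Lemma aut_pairE (s : G) b : aut_pair s b = (if b then s else s^-1)%g :> (R -> R).
Proof. by case: b. Qed.

Lemma aut_expand d (s t : G) l : sr_degree_le d (t (x_ l)) ->
  s (t (x_ l)) = \sum_(m : 'X_{1..n < d.+1})
     sr_coef m (t (x_ l)) *: mmap1 (fun i => s (x_ i)) m.
Proof.
move=> td; rewrite {1}(sr_expand td) raddf_sum; apply: eq_bigr => m _ /=.
by rewrite linearZ /= aut_mono.
Qed.

Lemma sr_degree_cst d (f : R) : sr_degree_le 0 f -> sr_degree_le d f.
Proof. exact: sr_degree_mono. Qed.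

Lemma sr_degree1 : sr_degree_le 0 (1 : R).
Proof. by exists 1; rewrite ?rmorph1 // msize1. Qed.

Lemma sr_degree_mmap1 d (h : 'I_n -> R) (m : 'X_{1..n}) :
  (forall i, sr_degree_le d (h i)) -> sr_degree_le (d * mdeg m) (mmap1 h m).
Proof.
move=> hd; rewrite /mmap1 mdegE big_distrr /=.
elim: (index_enum _) => [|i r IHr]; first by rewrite !big_nil; apply: sr_degree1.
rewrite !big_cons; apply: sr_degreeM => //.
elim: (m i) => [|e IHe]; first by rewrite muln0; apply: sr_degree1.
by rewrite mulnS exprS; apply: sr_degreeM.
Qed.

Lemma sr_degree_aut d e (s t : G) l : (forall i, sr_degree_le d (s (x_ i))) ->
  sr_degree_le e (t (x_ l)) -> sr_degree_le (d * e) (s (t (x_ l))).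
Proof.
move=> sd te; rewrite (aut_expand s te).
apply/sr_degree_coef => u du; rewrite sr_coef_sum big1 // => m _.
rewrite sr_coefZ; have /sr_degree_coef -> := sr_degree_mmap1 m sd; first exact: mulr0.
by apply: leq_ltn_trans du; rewrite leq_mul2l -ltnS bmdeg orbT.
Qed.

Lemma var_coef_ext (s t : G) : (forall l, s (x_ l) = t (x_ l)) -> s = t.
Proof.
move=> st; apply: aut_ext => f; rewrite -(sr_piK f) !aut_pi.
by congr (mmap _ _ _); apply/funext => i.
Qed.

Lemma aut_coord_coef d (s : G) b l (m : 'X_{1..n < d.+1}) :
  aut_coord s (enum_rank (b, l, m)) = sr_coef m (aut_pair s b (x_ l)).
Proof. by rewrite /aut_coord enum_rankK. Qed.

Lemma aut_coord_inj d (s t : G) : aut_bounded d s -> aut_bounded d t ->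
  @aut_coord d s = @aut_coord d t -> s = t.
Proof.
move=> sd td st; apply: var_coef_ext => l; have [sl _] := sd l; have [tl _] := td l.
rewrite (sr_expand sl) (sr_expand tl); apply: eq_bigr => m _; congr (_ *: _).
have := congr1 (fun c => c (enum_rank ((true, l, m) : coord_index d))) st.
by rewrite !aut_coord_coef.
Qed.

Section Closed.
Variable d : nat.
Local Notation J := 'I_#|coord_index d|.

Definition img (a : J -> k) (b : bool) (l : 'I_n) : R :=
  \sum_(m : 'X_{1..n < d.+1}) a (enum_rank ((b, l, m) : coord_index d)) *: sr_pi D 'X_[m].

Definition comp_img (a : J -> k) (b : bool) (l : 'I_n) : R :=
  \sum_(m : 'X_{1..n < d.+1})
    a (enum_rank ((~~ b, l, m) : coord_index d)) *: mmap1 (img a b) m.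

Definition polyfun : set ((J -> k) -> k) :=
  [set f | exists p : {mpoly k[#|coord_index d|]}, f = (fun a => p.@[a])].

Lemma polyfun_cst a : polyfun (fun=> a).
Proof. by exists a%:MP; apply/funext => z; rewrite mevalC. Qed.
Lemma polyfunD f g : polyfun f -> polyfun g -> polyfun (fun z => f z + g z).
Proof. by move=> [p ->] [q ->]; exists (p + q); apply/funext => z; rewrite mevalD. Qed.
Lemma polyfunM f g : polyfun f -> polyfun g -> polyfun (fun z => f z * g z).
Proof. by move=> [p ->] [q ->]; exists (p * q); apply/funext => z; rewrite mevalM. Qed.
Lemma polyfun_var j : polyfun (fun a => a j).
Proof. by exists 'X_j; apply/funext => z; rewrite mevalXU. Qed.

Local Notation pgood := (good polyfun).

Lemma img_good b l : pgood (fun a => img a b l).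
Proof.
apply: (good_sum polyfun_cst polyfunD) => m.
apply: (goodZ polyfunM); first exact: polyfun_var.
exact: (good_cst polyfun_cst).
Qed.

Lemma comp_img_good b l : pgood (fun a => comp_img a b l).
Proof.
apply: (good_sum polyfun_cst polyfunD) => m.
apply: (goodZ polyfunM); first exact: polyfun_var.
by apply: (good_mmap1 polyfun_cst polyfunD polyfunM) => i; apply: img_good.
Qed.

Definition eqn : set ((J -> k) -> k) := [set f |
  [\/ exists b l m, ~~ face_mnm D (m : 'X_{1..n < d.+1}) /\
        f = (fun a => a (enum_rank ((b, l, m) : coord_index d))),
      exists b (s : {set 'I_n}) u, s \notin faces D /\
        f = (fun a => sr_coef u (\prod_(i in s) img a b i)) |
      exists b l u, f = (fun a => sr_coef u (comp_img a b l - x_ l)) ] ].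

Lemma eqn_polyfun f : eqn f -> polyfun f.
Proof.
case=> [[b [l [m [_ ->]]]]|[b [s [u [_ ->]]]]|[b [l [u ->]]]].
- exact: polyfun_var.
- by apply: (good_prod polyfun_cst polyfunD polyfunM) => i; apply: img_good.
- apply: (goodD polyfunD); first exact: comp_img_good.
  exact: (good_cst polyfun_cst).
Qed.

Section FromCoord.
Variables (a : J -> k) (ea : forall f, eqn f -> f a = 0).

Lemma img_ideal b p : p \in sr_ideal D -> mmap (in_alg R) (img a b) p = 0.
Proof.
move=> /asboolP[q ->]; rewrite raddf_sum big1 // => s sD /=.
rewrite rmorphM rmorph_prod /= [X in _ * X](_ : _ = 0) ?mulr0 //.
apply: sr_coef_inj => u; have -> : sr_coef u (0 : R) = 0.
  by rewrite -(scale0r 0) sr_coefZ mul0r.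
rewrite -[RHS](@ea (fun a => sr_coef u (\prod_(i in s) img a b i))); last first.
  by apply: Or32; exists b, s, u.
by congr (sr_coef u _); apply: eq_bigr => i _; rewrite mmapX mmap1U.
Qed.

Definition lift_img b (f : R) : R := mmap (in_alg R) (img a b)
  (repr (f : {ideal_quot (sr_ideal D : idealr {mpoly k[n]})})).

Lemma lift_pi b p : lift_img b (sr_pi D p) = mmap (in_alg R) (img a b) p.
Proof.
apply/eqP; rewrite -subr_eq0 /lift_img -mmapB img_ideal // -sr_pi_eq0 raddfB /= sr_piK.
by rewrite subrr.
Qed.

Lemma lift_linear b : linear (lift_img b).
Proof.
move=> c f g; rewrite -(sr_piK f) -(sr_piK g) -linearP !lift_pi.
by rewrite raddfD /= mmapZ /= mulr_algl.
Qed.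

Lemma lift_monoid b : monoid_morphism (lift_img b).
Proof.
split=> [|f g]; first by rewrite -[in LHS](rmorph1 (sr_pi D)) lift_pi rmorph1.
by rewrite -(sr_piK f) -(sr_piK g) -rmorphM !lift_pi rmorphM.
Qed.

HB.instance Definition _ b := GRing.isLinear.Build k R R *:%R (lift_img b) (lift_linear b).
HB.instance Definition _ b :=
  GRing.isMonoidMorphism.Build R R (lift_img b) (lift_monoid b).

Lemma lift_var b l : lift_img b (x_ l) = img a b l.
Proof. by rewrite lift_pi mmapX mmap1U. Qed.

Lemma lift_comp b l : lift_img b (img a (~~ b) l) = x_ l.
Proof.
apply: sr_coef_inj => u.
have : sr_coef u (comp_img a b l - x_ l) = 0.
  by apply: (@ea (fun a => sr_coef u (comp_img a b l - x_ l))); apply: Or33; exists b, l, u.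
rewrite -scaleN1r sr_coefD sr_coefZ mulN1r => /eqP; rewrite subr_eq0 => /eqP <-.
congr (sr_coef u _); rewrite raddf_sum; apply: eq_bigr => m _ /=.
by rewrite linearZ /= lift_pi mmapX.
Qed.

Lemma liftK b : cancel (lift_img (~~ b)) (lift_img b).
Proof.
move=> f; rewrite -(sr_piK f); move: (repr _) => p.
elim/mpolyind: p => [|c m p _ _ IHp].
  by rewrite (raddf0 (sr_pi D)) (raddf0 (lift_img _)) (raddf0 (lift_img _)).
rewrite (linearP (sr_pi D)) (linearP (lift_img _)) (linearP (lift_img _)) /= IHp.
congr (_ *: _ + _).
rewrite lift_pi mmapX /mmap1 mpolyXE_id !rmorph_prod; apply: eq_bigr => i _ /=.
by rewrite !rmorphXn /= lift_comp.
Qed.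

Definition lift_aut : G :=
  AlgAut (liftK false) (liftK true) (lift_linear true) (lift_monoid true).

Lemma lift_pair b l : aut_pair lift_aut b (x_ l) = img a b l.
Proof. by case: b; rewrite /= lift_var. Qed.

Lemma lift_bounded : aut_bounded d lift_aut.
Proof.
have H b l : sr_degree_le d (img a b l).
  apply/sr_degree_coef => u du; rewrite sr_coef_sum big1 // => m _.
  rewrite sr_coefZ sr_coef_pi mcoeffX; case: eqP => [mE|]; last by rewrite if_same mulr0.
  by move: du; rewrite -mE ltnNge -ltnS bmdeg.
by move=> l; split; [move: (H true l)|move: (H false l)]; rewrite -lift_pair.
Qed.

Lemma lift_coord : @aut_coord d lift_aut = a.
Proof.
apply/funext => j; rewrite -[j]enum_valK; case: (enum_val j) => -[b l] m.
rewrite aut_coord_coef lift_pair.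
have [Fm|nFm] := boolP (face_mnm D m); last first.
  rewrite sr_coef_notface //; apply/esym/(@ea (fun a => a (enum_rank ((b, l, m) : coord_index d)))).
  by apply: Or31; exists b, l, m.
rewrite sr_coef_sum (bigD1 m) //= sr_coefZ sr_coef_pi Fm mcoeffX eqxx mulr1.
rewrite big1 ?addr0 // => u um; rewrite sr_coefZ sr_coef_pi Fm mcoeffX.
case: eqP => [uE|]; last by rewrite mulr0.
by case/eqP: um; apply: val_inj.
Qed.
End FromCoord.

Lemma coord_closed : zariski_closed (@aut_coord d @` aut_bounded d).
Proof.
exists [set p | eqn (fun a => p.@[a])]; apply/seteqP; split=> [_ [s sd <-]|a pa].
  move=> p; set c := aut_coord s.
  have cimg b l : img c b l = aut_pair s b (x_ l).
    have sl : sr_degree_le d (aut_pair s b (x_ l)) by case: b; have [] := sd l.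
    rewrite [RHS](sr_expand sl); apply: eq_bigr => m _.
    by rewrite /c aut_coord_coef.
  case=> [[b [l [m [nFm /(congr1 (fun f => f c)) ->]]]]|
          [b [u [m [uD /(congr1 (fun f => f c)) ->]]]]|
          [b [l [m /(congr1 (fun f => f c)) ->]]]].
  - by rewrite /c aut_coord_coef sr_coef_notface.
  - have -> : \prod_(i in u) img c b i =
        (if b then s else s^-1)%g (sr_pi D (\prod_(i in u) 'X_i)).
      by rewrite !rmorph_prod; apply: eq_bigr => i _; rewrite cimg aut_pairE.
    have -> : sr_pi D (\prod_(i in u) 'X_i) = 0 :> R.
      apply/eqP; rewrite sr_pi_eq0; apply/asboolP.
      exists (fun v => if v == u then 1 else 0).
      rewrite (bigD1 u) //= eqxx mul1r [X in _ + X]big1 ?addr0 // => v /andP[_ /negPf ->].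
      by rewrite mul0r.
    by rewrite raddf0 -(scale0r 0) sr_coefZ mul0r.
  have -> : comp_img c b l = x_ l.
    rewrite /comp_img; have -> : img c b = fun i => aut_pair s b (x_ i).
      by apply/funext => i.
    have sl : sr_degree_le d (aut_pair s (~~ b) (x_ l)) by case: (b); have [] := sd l.
    rewrite aut_pairE in sl; under eq_bigr do rewrite /c aut_coord_coef !aut_pairE.
    rewrite -aut_expand //; case: (b) => /=; [exact: aut_invK|exact: aut_funK].
  by rewrite subrr -(scale0r 0) sr_coefZ mul0r.
have ea f : eqn f -> f a = 0.
  by move=> ef; have [p fE] := eqn_polyfun ef; rewrite fE in ef *; apply: pa.
by exists (lift_aut ea); [apply: lift_bounded | apply: lift_coord].
Qed.

End Closed.

Lemma aut_piece_variety d : variety (aut_piece d).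
Proof. by apply: zariski_variety; [apply: aut_coord_inj | apply: coord_closed]. Qed.

Lemma aut_bounded_mono d e s : (d <= e)%N -> aut_bounded d s -> aut_bounded e s.
Proof.
by move=> de sd l; have [sl il] := sd l; split; apply: sr_degree_mono; eassumption.
Qed.

Lemma aut_piece_immersion d : closed_immersion (aut_piece d) (aut_piece d.+1) id.
Proof.
have up (m : 'X_{1..n < d.+1}) : (mdeg m < d.+2)%N by apply: leq_trans (bmdeg m) _.
pose P (j : 'I_#|coord_index d|) : {mpoly k[#|coord_index d.+1|]} :=
  let: (b, l, m) := enum_val j in
  'X_(enum_rank ((b, l, BMultinom (up m)) : coord_index d.+1)).
pose P' (j : 'I_#|coord_index d.+1|) : {mpoly k[#|coord_index d|]} :=
  let: (b, l, m) := enum_val j in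
  if insub (m : 'X_{1..n}) is Some m' then 'X_(enum_rank ((b, l, m') : coord_index d))
  else 0.
pose S : set {mpoly k[#|coord_index d.+1|]} := [set p | exists b l m,
  (d < mdeg (m : 'X_{1..n < d.+2}))%N /\
  p = 'X_(enum_rank ((b, l, m) : coord_index d.+1))].
have bounded_pair e s b l : aut_bounded e s -> sr_degree_le e (aut_pair s b (x_ l)).
  by move=> /(_ l)[sl il]; case: b.
apply: (@zariski_immersion _ _ _ _ _ _ _ _ P P' S).
- move=> s j sd; rewrite /P -[j in LHS]enum_valK; case: (enum_val j) => -[b l] m.
  by rewrite mevalXU !aut_coord_coef.
- move=> s j sd; rewrite /P' -[j in LHS]enum_valK; case: (enum_val j) => -[b l] m.
  rewrite aut_coord_coef; case: insubP => [m' _ mE|].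
    by rewrite mevalXU aut_coord_coef -mE.
  rewrite ltnS -ltnNge => dm; rewrite meval0.
  by have /sr_degree_coef -> := bounded_pair d s b l sd.
apply/seteqP; split=> [s sd|s [/= sd s0]].
  split; first exact: aut_bounded_mono sd.
  move=> _ [b [l [m [dm ->]]]]; rewrite mevalXU aut_coord_coef.
  by have /sr_degree_coef -> := bounded_pair d s b l sd.
have H b l : sr_degree_le d (aut_pair s b (x_ l)).
  apply/sr_degree_coef => m dm; have [dm'|dm'] := ltnP (mdeg m) d.+2; last first.
    by have /sr_degree_coef -> := bounded_pair d.+1 s b l sd.
  have := s0 'X_(enum_rank ((b, l, BMultinom dm') : coord_index d.+1)).
  rewrite mevalXU aut_coord_coef; apply.
  by exists b, l, (BMultinom dm').
by move=> l; split; [apply: (H true)|apply: (H false)].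
Qed.

Lemma aut_piece_cover s : exists d, aut_bounded d s.
Proof.
have deg f : exists d, @sr_degree_le k n D d f.
  by rewrite -(sr_piK f); move: (repr _) => p; exists (msize p); exists p.
have degs (F : 'I_n -> R) : exists d, forall l, sr_degree_le d (F l).
  have [d dP] := choice (fun l => deg (F l)).
  exists (\max_l d l) => l; apply: sr_degree_mono (dP l).
  exact: (leq_bigmax l).
have [d dP] := degs (fun l => s (x_ l)).
have [e eP] := degs (fun l => aut_inv s (x_ l)).
exists (maxn d e) => l; split.
  by apply: sr_degree_mono (dP l); apply: leq_maxl.
by apply: sr_degree_mono (eP l); apply: leq_maxr.
Qed.

Definition aut_var : indVariety k G :=
  IndVariety aut_piece_variety aut_piece_immersion aut_piece_cover.

Lemma regular_pair (T : Type) (X : kspace k T) (f : T -> G) d b l :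
  (forall x, supp X x -> aut_bounded d (f x)) ->
  (forall j, regular X (supp X) (fun x => @aut_coord d (f x) j)) ->
  good (regular X (supp X)) (fun x => aut_pair (f x) b (x_ l)).
Proof.
move=> fd fr m; have So := opens_supp X.
have [dm|dm] := ltnP (mdeg m) d.+1.
  apply: regular_ext (fr (enum_rank ((b, l, BMultinom dm) : coord_index d))) => // x _.
  exact: aut_coord_coef.
apply: regular_ext (regular_cst 0 So) => // x /fd /(_ l) [sl il].
by case: b; [move/sr_degree_coef: sl | move/sr_degree_coef: il] => ->.
Qed.

Lemma aut_inversion : ind_morphism aut_piece aut_piece (fun s : G => s^-1)%g.
Proof.
move=> d; exists d; apply: to_zariski => [s sd l|j].
  by have [sl il] := sd l; split.
rewrite -[j]enum_valK; case: (enum_val j) => -[b l] m.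
have So := opens_supp (aut_piece d).
apply: regular_ext
  (@zariski_regular _ _ _ _ _ (enum_rank ((~~ b, l, m) : coord_index d))) => // s _.
by rewrite !aut_coord_coef; case: b.
Qed.

Lemma aut_multiplication :
  ind_morphism (fun d => prod_space (aut_piece d) (aut_piece d)) aut_piece
    (fun z : G * G => z.1 * z.2)%g.
Proof.
move=> d; exists (d * d)%N; apply: to_zariski => [[s t] [/= sd td] l|j].
  split; first by apply: (@sr_degree_aut d d s t l) => [i|];
    [have [] := sd i | have [] := td l].
  by apply: (@sr_degree_aut d d (t^-1)%g (s^-1)%g l) => [i|];
    [have [] := td i | have [] := sd l].
rewrite -[j]enum_valK; case: (enum_val j) => -[b l] m.
pose X := prod_space (aut_piece d) (aut_piece d).
have So := opens_supp X.
have P1 b' i : good (regular X (supp X)) (fun z => aut_pair z.1 b' (x_ i)).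
  apply: (@regular_pair _ _ _ d) => [z []//|j'].
  apply: (@regular_fst _ _ _ (aut_piece d) (aut_piece d) (fun s => aut_coord s j')).
  exact: zariski_regular.
have P2 b' i : good (regular X (supp X)) (fun z => aut_pair z.2 b' (x_ i)).
  apply: (@regular_pair _ _ _ d) => [z []//|j'].
  apply: (@regular_snd _ _ _ (aut_piece d) (aut_piece d) (fun s => aut_coord s j')).
  exact: zariski_regular.
have rc a : regular X (supp X) (fun=> a) by apply: regular_cst.
have rD f g : regular X (supp X) f -> regular X (supp X) g ->
  regular X (supp X) (fun z => f z + g z) by apply: regularD.
have rM f g : regular X (supp X) f -> regular X (supp X) g ->
  regular X (supp X) (fun z => f z * g z) by apply: regularM.
pose F (z : G * G) : R := \sum_(u : 'X_{1..n < d.+1})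
  sr_coef u (aut_pair (if b then z.2 else z.1) b (x_ l)) *:
  mmap1 (fun i => aut_pair (if b then z.1 else z.2) b (x_ i)) u.
have gF : good (regular X (supp X)) F.
  apply: (good_sum rc rD) => u; apply: (goodZ rM).
    by case: (b); [apply: P2|apply: P1].
  by apply: (good_mmap1 rc rD rM) => i; case: (b); [apply: P1|apply: P2].
apply: regular_ext (gF m) => // -[s t] [/= sd td].
rewrite aut_coord_coef /F; congr (sr_coef _ _).
case: (b) => /=.
  by rewrite -aut_expand //; have [] := td l.
by rewrite -(@aut_expand d (t^-1)%g (s^-1)%g) //; have [] := sd l.
Qed.

Definition autX : indGroup k :=
  @IndGroup k (alg_aut R : groupType) aut_var aut_multiplication aut_inversion.

End AutIndGroup.

(* Isomorphism of the affine [k]-schemes [Spec A] and [Spec B], i.e. of their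
   coordinate [k]-algebras. *)
Definition spec_iso (k : fieldType) (A B : comAlgType k) : Prop :=
  exists f : {lrmorphism A -> B}, bijective f.

Definition subgroup (G : groupType) (H : set G) : Prop :=
  H 1%g /\ forall x y, H x -> H y -> H (x * y^-1)%g.

Definition cyclic_subgroup (G : groupType) (x : G) : set G :=
  [set y | exists m : nat, y = (x ^+ m)%g \/ y = (x ^- m)%g]%classic.

(* [G] is the internal semidirect product of [N] (normal) by [H]. *)
Definition semidirect (G : groupType) (N H : set G) : Prop :=
  [/\ subgroup N, forall x g, N x -> N (g * x * g^-1)%g, subgroup H,
      forall x, N x -> H x -> x = 1%g &
      forall g, exists x y, [/\ N x, H y & g = (x * y)%g]].

(* "If [D], [D'] satisfy [P] and their automorphism groups are isomorphic as
   ind-groups, then [D] and [D'], and their Stanley-Reisner varieties, are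
   isomorphic"; with [P := fully_exposed] this is a theorem, with [P] always true
   it is that statement with the hypothesis removed. *)
Definition aut_determines (k : fieldType) (P : forall n, complex n -> Prop) : Prop :=
  forall n n' (D : complex n) (D' : complex n'), P n D -> P n' D' ->
    indGroup_iso (autX k D) (autX k D') ->
    complex_iso D D' /\ spec_iso (sr_ring k D) (sr_ring k D').

Section GeneratedComplex.
Variables (n : nat) (Fs : seq {set 'I_n}) (i0 : 'I_n).
Hypothesis cover_Fs : forall i, has (fun F : {set 'I_n} => i \in F) Fs.

(* The complex whose facets are the maximal members of [Fs]. *)
Definition generated_faces : {set {set 'I_n}} :=
  [set S : {set 'I_n} | has (fun F : {set 'I_n} => S \subset F) Fs]%SET.

Fact generated_faces1 i : [set i]%SET \in generated_faces.
Proof. by rewrite inE; under eq_has => F do rewrite finset.sub1set; apply: cover_Fs. Qed.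

Fact generated_faces_sub (S S' : {set 'I_n}) :
  S \subset S' -> S' \in generated_faces -> S \in generated_faces.
Proof.
move=> SS'; rewrite !inE => /hasP[F FFs S'F]; apply/hasP; exists F => //.
exact: fintype.subset_trans S'F.
Qed.

Fact generated_faces0 : finset.set0 \in generated_faces.
Proof. by apply: generated_faces_sub (generated_faces1 i0); apply: finset.sub0set. Qed.

Definition generated_complex : complex n :=
  Complex generated_faces0 generated_faces1 generated_faces_sub.

End GeneratedComplex.

(* Vertices are labelled from 1: [vtx i] has value [i - 1]. *)
Definition vtx (i : nat) : 'I_5 := inord i.-1.

Definition facets1 : seq {set 'I_5} :=
  [:: [set vtx 1; vtx 2]; [set vtx 2; vtx 3]; [set vtx 3; vtx 4];
      [set vtx 4; vtx 5]]%SET.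

Definition facets2 : seq {set 'I_5} :=
  [:: [set vtx 1; vtx 2]; [set vtx 2; vtx 4]; [set vtx 4; vtx 5];
      [set vtx 3]]%SET.

Fact facets1_cover i : has (fun F : {set 'I_5} => i \in F) facets1.
Proof.
by case: i => -[|[|[|[|[|//]]]]] ip; rewrite /= !inE -!val_eqE /= !inordK.
Qed.

Fact facets2_cover i : has (fun F : {set 'I_5} => i \in F) facets2.
Proof.
by case: i => -[|[|[|[|[|//]]]]] ip; rewrite /= !inE -!val_eqE /= !inordK.
Qed.

Definition Delta1 : complex 5 := generated_complex (vtx 1) facets1_cover.
Definition Delta2 : complex 5 := generated_complex (vtx 1) facets2_cover.

Definition phi_formula (k : fieldType) (D : complex 5) (t : 'I_5 -> k)
    (h g : {poly k}) (s : alg_aut (sr_ring k D)) : Prop :=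
  let x i := sr_var k D (vtx i) in
  [/\ s (x 1%N) = t (vtx 1) *: x 1%N,
      s (x 2%N) = t (vtx 2) *: x 2%N + x 1%N * horner_alg (x 1%N) h,
      s (x 3%N) = t (vtx 3) *: x 3%N,
      s (x 4%N) = t (vtx 4) *: x 4%N + x 5%N * horner_alg (x 5%N) g &
      s (x 5%N) = t (vtx 5) *: x 5%N].

Definition phi_set (k : fieldType) (D : complex 5) : set (alg_aut (sr_ring k D)) :=
  [set s | exists t h g, (forall i, t i != 0) /\ phi_formula t h g s]%classic.

Definition pi_perm : {perm 'I_5} :=
  (tperm (vtx 1) (vtx 5) * tperm (vtx 2) (vtx 4))%g.

(* Main.v *)
Require Import Defs.
From HB Require Import structures.
From mathcomp Require Import all_boot fingroup perm.
From mathcomp Require Import all_order all_algebra generic_quotient ring_quotient.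
From mathcomp Require Import boolp classical_sets.
From mathcomp Require Import mpoly.

Set Implicit Arguments.
Unset Strict Implicit.
Unset Printing Implicit Defensive.

Import GRing.Theory.
Local Open Scope ring_scope.

(** Both varieties are unions of coordinate subspaces through the origin, one for
    each facet, and an automorphism permutes these irreducible components together
    with their intersections.  Which components meet outside the origin is
    therefore an invariant: for both complexes this graph on the four facets leaves
    only the identity and the reflection [pi], and the graphs of the two complexes
    differ (the line [{3}] of the second complex meets every other component in the
    origin alone), so that the varieties are not isomorphic
    ([matching_of_facets], [Delta_matching]).

    Up to the reflection, an automorphism [s] thus preserves every component, hence
    every intersection of components: the origin, the axes [{2}] and [{4}], and for
    the first complex also [{3}].  Two facts then determine [s].  If [s] preserves a
    component [F] and its hyperplane [x_i = 0], it rescales [x_i] on [F], because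
    the quotient of [s x_i] by [x_i] is invertible ([preserved_hyperplane]).  If [s]
    preserves a plane with coordinates [x_i], [x_j] and rescales [x_i], then it is
    an automorphism of [k[x_i][x_j]] semilinear over [k[x_i]], so [s x_j] is affine
    in [x_j] with a constant leading coefficient ([preserved_plane]).  The
    axes of [x_1] and [x_5] need not be preserved, so on the planes [{1, 2}] and
    [{4, 5}] only the second fact applies to [x_2] and [x_4], and it leaves exactly
    the shears [phi].  Conversely the
    shears preserve every component because each facet through [1] contains [2] and
    each facet through [5] contains [4] ([phi_img_vanish], [phi_exists]).  Thus the
    shears are the kernel of the action on the components, which makes them a normal
    subgroup complemented by the reflection ([fixes_facets_phi],
    [Delta_semidirect]).

    In both rings the image of a variable under a shear is a combination of powers
    of single variables, and such monomials are standard for every complex.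
    Matching the automorphisms of the two rings that have the same parameters hence
    leaves unchanged all the coefficients that are the coordinates of the ind-group,
    and it is a homomorphism since the composition law of the parameters does not
    see the complex ([params_mul], [transfer_morphism]). *)

(** * Evaluating a Stanley-Reisner ring and restricting to its faces *)

Lemma mpoly_rmorph_ext (k : nzRingType) (n : nat) (A : nzRingType)
    (f g : {rmorphism {mpoly k[n]} -> A}) :
  (forall a, f a%:MP = g a%:MP) -> (forall i, f 'X_i = g 'X_i) -> f =1 g.
Proof.
move=> fgC fgX p; rewrite (mpolyE p) !raddf_sum; apply: eq_bigr => m _ /=.
rewrite -mul_mpolyC !rmorphM /= fgC mpolyXE_id !rmorph_prod; congr (_ * _).
by apply: eq_bigr => i _ /=; rewrite !rmorphXn /= fgX.
Qed.

Section Evaluation.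
Variables (k : fieldType) (n : nat) (D : complex n) (A : comNzRingType).
Local Notation R := (sr_ring k D).
Local Notation x_ := (sr_var k D).

Definition kills_nonfaces (v : 'I_n -> A) : Prop :=
  forall S : {set 'I_n}, S \notin faces D -> \prod_(i in S) v i = 0.

Variables (c : {rmorphism k -> A}) (v : 'I_n -> A).

Definition sr_eval of kills_nonfaces v := fun f : R =>
  mmap c v (repr (f : {ideal_quot (sr_ideal D : idealr {mpoly k[n]})})).

Hypothesis hv : kills_nonfaces v.

Lemma sr_eval_pi (p : {mpoly k[n]}) : sr_eval hv (sr_pi D p) = mmap c v p.
Proof.
have ideal0 q : q \in sr_ideal D -> mmap c v q = 0.
  move=> /asboolP[a ->]; rewrite raddf_sum big1 // => S SD /=.
  rewrite rmorphM rmorph_prod /= (eq_bigr v) ?hv ?mulr0 // => i _.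
  by rewrite mmapX mmap1U.
apply/eqP; rewrite -subr_eq0 /sr_eval -mmapB ideal0 // -sr_pi_eq0 raddfB /= sr_piK.
by rewrite subrr.
Qed.

Fact sr_eval_is_zmod_morphism : zmod_morphism (sr_eval hv).
Proof.
by move=> f g; rewrite -(sr_piK f) -(sr_piK g) -raddfB !sr_eval_pi mmapB.
Qed.
Fact sr_eval_is_monoid_morphism : monoid_morphism (sr_eval hv).
Proof.
split=> [|f g]; first by rewrite -[in LHS](rmorph1 (sr_pi D)) sr_eval_pi rmorph1.
by rewrite -(sr_piK f) -(sr_piK g) -rmorphM !sr_eval_pi rmorphM.
Qed.
HB.instance Definition _ :=
  GRing.isZmodMorphism.Build R A (sr_eval hv) sr_eval_is_zmod_morphism.
HB.instance Definition _ :=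
  GRing.isMonoidMorphism.Build R A (sr_eval hv) sr_eval_is_monoid_morphism.

Lemma sr_eval_var i : sr_eval hv (x_ i) = v i.
Proof. by rewrite sr_eval_pi mmapX mmap1U. Qed.

Lemma sr_evalZ a f : sr_eval hv (a *: f) = c a * sr_eval hv f.
Proof. by rewrite rmorphM /= sr_eval_pi mmapC. Qed.

End Evaluation.

Section Restriction.
Variables (k : fieldType) (n : nat) (D : complex n).
Local Notation R := (sr_ring k D).
Local Notation x_ := (sr_var k D).

Lemma sr_rmorph_ext (A : nzRingType) (f g : {rmorphism R -> A}) :
  (forall a, f a%:A = g a%:A) -> (forall i, f (x_ i) = g (x_ i)) -> f =1 g.
Proof.
move=> fgC fgX u; rewrite -(sr_piK u); move: (repr _) => p.
apply: (@mpoly_rmorph_ext _ _ _ (f \o sr_pi D) (g \o sr_pi D)) => //= a.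
have -> : sr_pi D a%:MP = a%:A by rewrite -alg_mpolyC (linearZZ (sr_pi D)) rmorph1.
exact: fgC.
Qed.

Lemma sr_lrmorph_ext (A : lalgType k) (f g : {lrmorphism R -> A}) :
  (forall i, f (x_ i) = g (x_ i)) -> f =1 g.
Proof.
move=> fg; apply: (@sr_rmorph_ext A f g) => [a|//].
by rewrite /= (linearZZ f) (linearZZ g) !rmorph1.
Qed.

Definition msupport (m : 'X_{1..n}) : {set 'I_n} := [set i | m i != 0%N].

(** Restricting to zero on the part of the variety inside the coordinate subspace
    spanned by [A]; for a face [A] this defines the prime ideal generated by the
    variables outside [A]. *)
Definition vanish (A : {set 'I_n}) (f : R) : Prop :=
  forall m, msupport m \subset A -> sr_coef m f = 0.

Lemma vanish_sub (A B : {set 'I_n}) f : B \subset A -> vanish A f -> vanish B f.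
Proof. by move=> BA fA m mB; apply: fA; apply: fintype.subset_trans BA. Qed.

Section Face.
Variables (A : {set 'I_n}) (FA : A \in faces D).

Definition face_var (i : 'I_n) : {mpoly k[n]} := if i \in A then 'X_i else 0.

Fact face_var_kills : kills_nonfaces D face_var.
Proof.
move=> S SD; have [i iS iA] : exists2 i, i \in S & i \notin A.
  by apply/fintype.subsetPn; apply: contra SD => /faces_sub; apply.
by rewrite (bigD1 i) //= /face_var (negPf iA) mul0r.
Qed.

(** Restriction to the subspace spanned by the face [A]. *)
Definition face_proj : R -> {mpoly k[n]} := sr_eval (@mpolyC n k) face_var_kills.
HB.instance Definition _ := GRing.RMorphism.on face_proj.
Fact face_proj_is_scalable : scalable face_proj.
Proof. by move=> a f; rewrite /face_proj sr_evalZ mul_mpolyC. Qed.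
HB.instance Definition _ :=
  GRing.isScalable.Build k R {mpoly k[n]} *:%R face_proj face_proj_is_scalable.

Lemma face_proj_var i : face_proj (x_ i) = if i \in A then 'X_i else 0.
Proof. exact: sr_eval_var. Qed.

Lemma mcoeff_face_proj m f :
  (face_proj f)@_m = if msupport m \subset A then sr_coef m f else 0.
Proof.
have mono u : face_proj (sr_pi D 'X_[u]) =
    if msupport u \subset A then 'X_[u] else 0.
  rewrite /face_proj sr_eval_pi mmapX /mmap1; case: ifP => [uA|/fintype.subsetPn[i]].
    rewrite [RHS]mpolyXE_id; apply: eq_bigr => i _; rewrite /face_var.
    case: ifP => // /negP iA; suff -> : u i = 0%N by rewrite !expr0.
    apply/eqP; apply/negP => ui; apply: iA.
    by apply: (fintype.subsetP uA); rewrite inE; apply/negP.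
  rewrite inE => ui iA; rewrite (bigD1 i) //= /face_var (negPf iA).
  by rewrite expr0n (negPf ui) mul0r.
rewrite -(sr_piK f); move: (repr _) => p; rewrite sr_coef_pi.
rewrite [in LHS](mpolyE p) (raddf_sum (sr_pi D)) (raddf_sum face_proj) raddf_sum /=.
under eq_bigr => u _ do rewrite (linearZZ (sr_pi D)) (linearZZ face_proj) /= mono mcoeffZ.
have -> : (if msupport m \subset A then if face_mnm D m then p@_m else 0 else 0) =
    if msupport m \subset A then p@_m else 0.
  by case: ifP => // mA; have -> : face_mnm D m by apply: faces_sub FA.
transitivity (if msupport m \subset A then
    (\sum_(u <- msupp p) p@_u *: 'X_[u] : {mpoly k[n]})@_m else 0); last by rewrite -mpolyE.
case: ifP => mA.
  rewrite raddf_sum; apply: eq_bigr => u _; rewrite /= mcoeffZ; case: ifP => // uA.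
  rewrite mcoeffX mcoeff0; case: eqP => // um; by rewrite um mA in uA.
apply: big1 => u _; case: ifP => uA; rewrite ?mcoeff0 ?mulr0 // mcoeffX.
by case: eqP => [um|]; rewrite ?mulr0 //; rewrite um mA in uA.
Qed.

Lemma vanish_face f : vanish A f <-> face_proj f = 0.
Proof.
split=> [f0|f0 m mA].
  by apply/mpolyP => m; rewrite mcoeff_face_proj mcoeff0; case: ifP => // /f0.
by have := mcoeff_face_proj m f; rewrite mA f0 mcoeff0.
Qed.

End Face.

Lemma vanish_var A i : vanish A (x_ i) <-> i \notin A.
Proof.
have F1 : face_mnm D U_(i).
  apply: (faces_sub _ (faces1 D i)); apply/fintype.subsetP => j.
  by rewrite !inE mnm1E eqb0 negbK eq_sym.
split=> [xA|iA m mA]; last first.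
  rewrite sr_coef_pi mcoeffX; case: eqP => [mE|]; rewrite ?if_same //.
  by case/negP: iA; apply: (fintype.subsetP mA); rewrite inE -mE mnmE eqxx.
apply/negP => iA; have mA : msupport U_(i) \subset A.
  by apply/fintype.subsetP => j; rewrite inE mnm1E eqb0 negbK => /eqP <-.
by have /eqP := xA _ mA; rewrite sr_coef_pi F1 mcoeffX eqxx oner_eq0.
Qed.

Lemma prod_nonface S : S \notin faces D -> \prod_(i in S) x_ i = 0.
Proof.
move=> SD; rewrite -(rmorph_prod (sr_pi D)); apply/eqP; rewrite sr_pi_eq0; apply/asboolP.
exists (fun T => if T == S then 1 else 0).
rewrite (bigD1 S) //= eqxx mul1r [X in _ + X]big1 ?addr0 // => T /andP[_ /negPf ->].
by rewrite mul0r.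
Qed.

Lemma facet_face F : facet D F -> F \in faces D. Proof. by case/andP. Qed.

Lemma facet_max F S : facet D F -> S \in faces D -> F \subset S -> S = F.
Proof. by case/andP=> _ /forallP/(_ S)/implyP + SD => /(_ SD)/implyP + FS => /(_ FS)/eqP. Qed.

Lemma face_facet S : S \in faces D -> exists2 F, facet D F & S \subset F.
Proof.
move=> SD; have [F /maxsetP[FD Fmax] SF] := @maxset_exists _ (fun F => F \in faces D) S SD.
exists F => //; rewrite /facet FD; apply/forallP => T; apply/implyP => TD.
by apply/implyP => FT; rewrite (Fmax T).
Qed.

(** A Stanley-Reisner ring is reduced: a function on the variety is determined by
    its restrictions to the components. *)
Lemma vanish_eq0 f : (forall F, facet D F -> vanish F f) -> f = 0.
Proof.
move=> f0; apply: sr_coef_inj => m; rewrite -(raddf0 (sr_pi D)) sr_coef_pi mcoeff0 if_same.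
have [Fm|nFm] := boolP (face_mnm D m); last by rewrite sr_coef_notface.
by have [F FD mF] := face_facet Fm; apply: f0 mF.
Qed.

(** On a component [F] a nonface product has a factor indexed outside [F]. *)
Lemma kills_nonfaces_facets (v : 'I_n -> R) :
  (forall F, facet D F -> forall i, i \notin F -> vanish F (v i)) ->
  kills_nonfaces D v.
Proof.
move=> v0 S SD; apply: vanish_eq0 => F FD; apply/(vanish_face (facet_face FD)).
have [i iS iF] : exists2 i, i \in S & i \notin F.
  by apply/fintype.subsetPn; apply: contra SD => /faces_sub; apply; apply: facet_face.
rewrite rmorph_prod /= (bigD1 i) //=.
by have /(vanish_face (facet_face FD)) -> := v0 F FD i iF; rewrite mul0r.
Qed.

End Restriction.

(** * Isomorphisms permute the components *)

Section Isomorphisms.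
Variable k : fieldType.

(** [s] is the comorphism of a map of varieties that carries the subspace [A] into
    the subspace [B]; the variables outside [B] generate the ideal of [B]. *)
Definition sends n n' (D : complex n) (D' : complex n')
    (s : sr_ring k D -> sr_ring k D') (A : {set 'I_n'}) (B : {set 'I_n}) : Prop :=
  forall i, i \notin B -> vanish A (s (sr_var k D i)).

Lemma sendsI n n' (D : complex n) (D' : complex n')
    (s : sr_ring k D -> sr_ring k D') A A' B B' :
  sends s A B -> sends s A' B' -> sends s (A :&: A')%SET (B :&: B')%SET.
Proof.
move=> sA sA' i; rewrite finset.inE negb_and => /orP[/sA|/sA']; apply: vanish_sub.
  exact: finset.subsetIl.
exact: finset.subsetIr.
Qed.

Lemma sends_id n (D : complex n) A B : sends (@idfun (sr_ring k D)) A B -> A \subset B.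
Proof.
move=> sAB; apply/fintype.subsetP => i; apply: contraTT => iB.
exact/vanish_var/sAB.
Qed.

(** Restricted to [A], the map factors through the inclusion of [B]. *)
Lemma sends_proj n n' (D : complex n) (D' : complex n')
    (s : {lrmorphism sr_ring k D -> sr_ring k D'}) A B
    (FA : A \in faces D') (FB : B \in faces D) f : sends s A B ->
  face_proj FA (s f) = face_proj FA (s (sr_pi D (face_proj FB f))).
Proof.
move=> sAB; apply: (@sr_lrmorph_ext _ _ _ _ (face_proj FA \o s)
  (face_proj FA \o s \o sr_pi D \o face_proj FB)) => i /=.
rewrite face_proj_var; case: ifP => [//|/negbT /sAB iB].
by rewrite !raddf0; apply/(vanish_face FA).
Qed.

Lemma sends_vanish n n' (D : complex n) (D' : complex n')
    (s : {lrmorphism sr_ring k D -> sr_ring k D'}) A B f :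
  A \in faces D' -> B \in faces D -> sends s A B -> vanish B f -> vanish A (s f).
Proof.
move=> FA FB sAB /(vanish_face FB) f0; apply/(vanish_face FA).
by rewrite (sends_proj FA FB) // f0 !raddf0.
Qed.

Lemma sends_comp n n' n'' (D : complex n) (D' : complex n') (D'' : complex n'')
    (s : sr_ring k D -> sr_ring k D')
    (t : {lrmorphism sr_ring k D' -> sr_ring k D''}) A B C :
  A \in faces D'' -> B \in faces D' -> sends t A B -> sends s B C ->
  sends (t \o s) A C.
Proof. by move=> FA FB tAB sBC i /sBC; apply: sends_vanish. Qed.

(** A component is irreducible, so its image lies in a single coordinate subspace:
    the variables whose image does not vanish identically on [A] have nonzero
    product in a domain, hence form a face. *)
Lemma sends_face n n' (D : complex n) (D' : complex n')
    (s : {lrmorphism sr_ring k D -> sr_ring k D'}) A : A \in faces D' ->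
  exists2 F, facet D F & sends s A F.
Proof.
move=> FA; pose B := [set i | face_proj FA (s (sr_var k D i)) != 0]%SET.
have BD : B \in faces D.
  apply/negPn/negP => nB.
  have /eqP : face_proj FA (s (sr_pi D (\prod_(i in B) 'X_i))) = 0.
    have -> : sr_pi D (\prod_(i in B) 'X_i) = 0 :> sr_ring k D.
      by rewrite rmorph_prod; apply: prod_nonface.
    by rewrite !raddf0.
  rewrite !rmorph_prod /=; apply/negP/prodf_neq0 => i.
  by rewrite finset.inE.
have [F FD BF] := face_facet BD; exists F => // i iF; apply/(vanish_face FA)/eqP.
by apply: contraNT iF => iB; apply: (fintype.subsetP BF); rewrite finset.inE.
Qed.

Section Inverse.
Variables (n n' : nat) (D : complex n) (D' : complex n').
Variables (s : {lrmorphism sr_ring k D -> sr_ring k D'}).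
Variables (s' : {lrmorphism sr_ring k D' -> sr_ring k D}).
Hypotheses (sK : cancel s s') (s'K : cancel s' s).

(** The isomorphism of varieties identifies the subspaces [A] and [B]. *)
Definition matches (A : {set 'I_n'}) (B : {set 'I_n}) : Prop :=
  sends s A B /\ sends s' B A.

Lemma matchesI A A' B B' : matches A B -> matches A' B' ->
  matches (A :&: A')%SET (B :&: B')%SET.
Proof. by move=> [? ?] [? ?]; split; apply: sendsI. Qed.

(** Following a component forth and back lands in a component that contains the
    original one, hence in the original one. *)
Lemma matches_facet F : facet D' F -> exists2 F', facet D F' & matches F F'.
Proof.
move=> FD; have FF := facet_face FD.
have [F' F'D sF] := sends_face s FF; have FF' := facet_face F'D.
have [F'' F''D s'F] := sends_face s' FF'; have FF'' := facet_face F''D.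
exists F' => //; split=> //; suff <- : F'' = F by [].
apply: (facet_max FD) => //; apply: (@sends_id _ D').
move=> i iF; have := sends_comp FF FF' sF s'F iF.
by rewrite /= s'K.
Qed.

Lemma matches_face_sub A A' B : A \in faces D' -> B \in faces D ->
  matches A B -> matches A' B -> A \subset A'.
Proof.
move=> FA FB [sA _] [_ s'B]; apply: (@sends_id _ D') => i iA'.
by have := sends_comp FA FB sA s'B iA'; rewrite /= s'K.
Qed.

(** A subspace matched with the origin carries only constant functions, so it has
    no coordinates. *)
Lemma matches_set0 A : A \in faces D' -> matches A finset.set0 -> A = finset.set0.
Proof.
move=> FA [sA _]; apply/eqP/set0Pn => -[i iA].
have := sends_proj FA (faces0 D) (s' (sr_var k D' i)) sA.
rewrite s'K face_proj_var iA; set f := s' _ => XiE.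
have f_cst : face_proj (faces0 D) f = (sr_coef 0%MM f)%:MP.
  apply/mpolyP => m; rewrite mcoeff_face_proj mcoeffC; case: eqVneq => [->|m0].
    case: ifP => [_|/negP[]]; rewrite ?mulr1 //.
    by apply/fintype.subsetP => j; rewrite finset.inE mnm0E.
  rewrite mulr0; case: ifP => // /fintype.subsetP ms; case/eqP: m0.
  apply/mnmP => j; rewrite mnm0E; have := ms j; rewrite !finset.inE.
  by case: (m j) => // ? /(_ isT).
move: XiE; rewrite f_cst -alg_mpolyC !linearZZ !rmorph1 alg_mpolyC.
move=> /(congr1 (mcoeff U_(i))); rewrite mcoeffX eqxx mcoeffC.
have /negPf -> : U_(i)%MM != 0%MM :> 'X_{1..n'}.
  by apply/eqP => /mnmP/(_ i); rewrite mnm1E mnm0E eqxx.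
by rewrite mulr0 => /eqP; rewrite oner_eq0.
Qed.

End Inverse.

Lemma matches_sym n n' (D : complex n) (D' : complex n')
    (s : {lrmorphism sr_ring k D -> sr_ring k D'})
    (s' : {lrmorphism sr_ring k D' -> sr_ring k D}) A B :
  matches s s' A B -> matches s' s B A.
Proof. by case. Qed.

(** Facets are listed and matched by their indices, so that what is left for given
    complexes is a finite check on sequences of numbers. *)
Lemma matching_of_facets n n' (D : complex n) (D' : complex n')
    (s : {lrmorphism sr_ring k D -> sr_ring k D'})
    (s' : {lrmorphism sr_ring k D' -> sr_ring k D})
    (Fs : seq {set 'I_n}) (Fs' : seq {set 'I_n'}) :
  cancel s s' -> cancel s' s -> facet D =i Fs -> facet D' =i Fs' -> uniq Fs' ->
  exists l : seq nat, [/\ size l = size Fs', uniq l, all (fun a => a < size Fs)%N l,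
    forall i, (i < size Fs')%N ->
      matches s s' (nth finset.set0 Fs' i) (nth finset.set0 Fs (nth 0%N l i)) &
    forall i j, (i < size Fs')%N -> (j < size Fs')%N ->
      (nth finset.set0 Fs' i :&: nth finset.set0 Fs' j == finset.set0)%SET =
      (nth finset.set0 Fs (nth 0%N l i) :&: nth finset.set0 Fs (nth 0%N l j)
        == finset.set0)%SET].
Proof.
move=> sK s'K FsE Fs'E uFs'.
have Fs_face F : F \in Fs -> F \in faces D by rewrite -FsE => /facet_face.
have Fs'_face F : F \in Fs' -> F \in faces D' by rewrite -Fs'E => /facet_face.
have [|S SP] := @choice _ _ (fun F F' => F \in Fs' -> F' \in Fs /\ matches s s' F F').
  move=> F.
  have [FF|/negP nF] := boolP (F \in Fs'); last by exists finset.set0.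
  have [|F' F'D m] := @matches_facet _ _ D D' s s' s'K F; first by rewrite -Fs'E in FF.
  by exists F' => _; split=> //; rewrite -FsE.
have Smem i : (i < size Fs')%N -> nth finset.set0 Fs' i \in Fs' by apply: mem_nth.
pose l := [seq index (S F) Fs | F <- Fs'].
have lE i : (i < size Fs')%N -> nth finset.set0 Fs (nth 0%N l i) = S (nth finset.set0 Fs' i).
  by move=> is'; rewrite (nth_map finset.set0) // nth_index //; have [] := SP _ (Smem i is').
exists l; split=> [|||i is'|i j is' js'].
- by rewrite size_map.
- rewrite map_inj_in_uniq // => F G FF GF /(congr1 (nth finset.set0 Fs)).
  have [SF mF] := SP F FF; have [SG mG] := SP G GF; rewrite !nth_index // => FG.
  rewrite -FG in mG.
  have FG' : F \subset G.
    by apply: (matches_face_sub s'K _ _ mF mG); [apply: Fs'_face | apply: Fs_face].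
  have FD : facet D' F by rewrite -[facet D' F]/(F \in facet D') Fs'E.
  exact: esym (facet_max FD (Fs'_face _ GF) FG').
- by apply/allP => _ /mapP[F FF ->]; rewrite index_mem; have [] := SP F FF.
- by rewrite lE //; have [] := SP _ (Smem i is').
rewrite !lE //; have [Si mi] := SP _ (Smem i is'); have [Sj mj] := SP _ (Smem j js').
have m := matchesI mi mj.
have F1 : (nth finset.set0 Fs' i :&: nth finset.set0 Fs' j)%SET \in faces D'.
  by apply: (faces_sub (finset.subsetIl _ _)); apply: Fs'_face; apply: Smem.
have F2 : (S (nth finset.set0 Fs' i) :&: S (nth finset.set0 Fs' j))%SET \in faces D.
  by apply: (faces_sub (finset.subsetIl _ _)); apply: Fs_face.
apply/eqP/eqP => E; rewrite E in m.
  exact: (matches_set0 sK F2 (matches_sym m)).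
exact: (matches_set0 s'K F1 m).
Qed.

End Isomorphisms.

(** * Automorphisms that preserve every component *)

Lemma mpoly_divX (R : comNzRingType) (n : nat) (i : 'I_n) (p : {mpoly R[n]}) :
  (forall m : 'X_{1..n}, m i = 0%N -> p@_m = 0) <-> exists q, p = q * 'X_i.
Proof.
split=> [p0|[q ->] m mi].
  exists (\sum_(m <- msupp p) p@_m *: 'X_[(m - U_(i))%MM]).
  rewrite {1}(mpolyE p) mulr_suml; apply: eq_bigr => m _; rewrite -scalerAl -mpolyXD.
  have [mi|mi] := eqVneq (m i) 0%N; first by rewrite p0 // !scale0r.
  rewrite submK //; apply/mnm_lepP => j; rewrite mnm1E.
  by case: eqP => // <-; rewrite lt0n.
apply: memN_msupp_eq0; rewrite (perm_mem (msuppMX _ _)); apply/mapP => -[u _ mE].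
by move: mi; rewrite mE mnmDE mnm1E eqxx.
Qed.

(** Degrees multiply under composition of polynomials over a domain, so only
    affine polynomials have a left inverse for composition. *)
Lemma comp_poly_eqX (A : idomainType) (w u : {poly A}) : w \Po u = 'X ->
  exists b c, b \is a GRing.unit /\ u = b%:P * 'X + c%:P.
Proof.
move=> wu; have := size_comp_poly w u; rewrite wu size_polyX /= => /esym /eqP.
rewrite muln_eq1 => /andP[/eqP sw /eqP su].
have aff (v : {poly A}) : (size v).-1 = 1%N -> v = (v`_1)%:P * 'X + (v`_0)%:P.
  move=> sv; apply/polyP => -[|[|e]]; rewrite coefD coefCM coefX coefC /=.
  - by rewrite mulr0 add0r.
  - by rewrite mulr1 addr0.
  by rewrite mulr0 addr0 nth_default //; case: (size v) sv => [|[|[|]]].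
exists u`_1, u`_0; split; last exact: aff.
move: wu; rewrite (aff w sw) comp_polyD comp_polyM comp_polyX !comp_polyC.
move=> /polyP/(_ 1%N); rewrite coefD coefCM coefC addr0 coefX => wu1.
by apply/unitrP; exists w`_1; split=> //; rewrite mulrC.
Qed.

Lemma lrmorph_horner_alg (k : comNzRingType) (A B : algType k)
    (f : {lrmorphism A -> B}) a (p : {poly k}) :
  f (horner_alg a p) = horner_alg (f a) p.
Proof.
elim/poly_ind: p => [|p c IHp]; first by rewrite !raddf0.
by rewrite !rmorphD !rmorphM /= IHp !horner_algX !horner_algC linearZZ rmorph1.
Qed.

Section PreservedFaces.
Variables (k : fieldType) (n : nat) (D : complex n).
Local Notation R := (sr_ring k D).
Local Notation x_ := (sr_var k D).

Lemma vanishB (A : {set 'I_n}) (FA : A \in faces D) (f g : R) :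
  vanish A (f - g) <-> face_proj FA f = face_proj FA g.
Proof.
rewrite (vanish_face FA) raddfB /=; split=> [/eqP|->]; last exact: subrr.
by rewrite subr_eq0 => /eqP.
Qed.

Lemma coef_face_proj (A : {set 'I_n}) (FA : A \in faces D) i (f : R) :
  i \in A -> (face_proj FA f)@_U_(i) = sr_coef U_(i)%MM f.
Proof.
move=> iA; rewrite mcoeff_face_proj; case: ifP => // /fintype.subsetPn[j].
by rewrite finset.inE mnm1E eqb0 negbK => /eqP <-; rewrite iA.
Qed.

Variables (s s' : {lrmorphism R -> R}).
Hypothesis s'K : cancel s' s.

(** For an automorphism preserving the components, the factor by which [x_i] is
    rescaled, up to terms in other variables. *)
Definition scaling (f : R -> R) (i : 'I_n) : k := sr_coef U_(i)%MM (f (x_ i)).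

(** On a preserved component [F] where the hyperplane [x_i = 0] is preserved, the
    image of [x_i] is a multiple of [x_i], and so is its preimage; the cofactor is
    therefore invertible, that is, a nonzero constant. *)
Lemma preserved_hyperplane F i : F \in faces D -> i \in F ->
  matches s s' F F -> matches s s' (F :\ i)%SET (F :\ i)%SET ->
  scaling s i != 0 /\ vanish F (s (x_ i) - scaling s i *: x_ i).
Proof.
move=> FF iF [sF s'F] [sH s'H].
have div (f : R) : vanish (F :\ i)%SET f -> exists q, face_proj FF f = q * 'X_i.
  move=> f0; apply/mpoly_divX => m mi; rewrite mcoeff_face_proj; case: ifP => // mF.
  apply: f0; apply/fintype.subsetP => j jm; rewrite !finset.inE (fintype.subsetP mF) // andbT.
  by apply: contraTneq jm => ->; rewrite finset.inE mi.
have iH : i \notin (F :\ i)%SET by rewrite !finset.inE eqxx.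
have [u uE] := div _ (sH i iH); have [u' u'E] := div _ (s'H i iH).
have := sends_proj FF FF (s' (x_ i)) sF.
rewrite s'K face_proj_var iF u'E !rmorphM /= -/(sr_var k D i) uE mulrA.
have Xi0 : 'X_i != 0 :> {mpoly k[n]} by rewrite -msize_poly_eq0 msizeX.
rewrite -{1}['X_i]mul1r => /(mulIf Xi0) /esym /mpoly_intro_unit.
case/andP=> /eqP uC uU; move: uE; rewrite uC => uE.
have tE : scaling s i = u@_0.
  rewrite /scaling -(coef_face_proj FF) // uE mul_mpolyC mcoeffZ mcoeffX eqxx.
  exact: mulr1.
split; first by rewrite tE -unitfE.
apply/(vanishB FF); rewrite (linearZZ (face_proj FF)) /= face_proj_var iF uE tE.
exact: mul_mpolyC.
Qed.

(** On a preserved plane where [x_i] is rescaled, the image of [x_j] is a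
    polynomial over [k[x_i]] with an inverse for composition, hence affine in
    [x_j]; its constant term vanishes at the origin. *)
Lemma preserved_plane i j a : i != j -> [set i; j]%SET \in faces D ->
  matches s s' [set i; j]%SET [set i; j]%SET ->
  vanish [set i; j]%SET (s (x_ i) - a *: x_ i) -> vanish finset.set0 (s (x_ j)) ->
  exists h, vanish [set i; j]%SET
    (s (x_ j) - (scaling s j *: x_ j + x_ i * horner_alg (x_ i) h)).
Proof.
set F := [set i; j]%SET => ij FF [sF s'F] /(vanishB FF) + s0.
have iF : i \in F by rewrite !finset.inE eqxx.
have jF : j \in F by rewrite !finset.inE eqxx orbT.
rewrite (linearZZ (face_proj FF)) /= face_proj_var iF => six.
(* [k[x_i, x_j]] as the ring of polynomials in [x_j] over [k[x_i]], and back *)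
pose to2 : {rmorphism {mpoly k[n]} -> {poly {poly k}}} :=
  mmap (@polyC {poly k} \o @polyC k)
    (fun l => if l == i then 'X%:P else if l == j then 'X else 0).
pose of2 : {rmorphism {poly {poly k}} -> {mpoly k[n]}} :=
  horner_eval ('X_j : {mpoly k[n]}) \o map_poly (horner_alg ('X_i : {mpoly k[n]})).
have to2i : to2 'X_i = 'X%:P by rewrite /to2 /= mmapX mmap1U eqxx.
have to2j : to2 'X_j = 'X by rewrite /to2 /= mmapX mmap1U eq_sym (negPf ij) eqxx.
have to2C b : to2 b%:MP = b%:P%:P by rewrite /to2 /= mmapC.
have to2K f : of2 (to2 (face_proj FF f)) = face_proj FF f.
  apply: (@sr_rmorph_ext _ _ _ _ (of2 \o to2 \o face_proj FF) (face_proj FF)) => [b|l] /=.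
    rewrite linearZZ rmorph1 alg_mpolyC to2C /of2 /= map_polyC /= /horner_eval hornerC.
    by rewrite horner_algC alg_mpolyC.
  rewrite face_proj_var !finset.inE; case: eqVneq => [->|_] /=.
    by rewrite to2i /of2 /= map_polyC /= /horner_eval hornerC horner_algX.
  case: eqVneq => [->|_]; last by rewrite !raddf0.
  by rewrite to2j /of2 /= map_polyX /horner_eval hornerX.
(* composing with [s] is substituting [a x_i] for [x_i] and the image of [x_j]
   for [x_j] *)
have comp_eq q : to2 (face_proj FF (s (sr_pi D q))) =
    map_poly (comp_poly (a *: 'X)) (to2 q) \Po to2 (face_proj FF (s (x_ j))).
  pose lhs : {rmorphism {mpoly k[n]} -> {poly {poly k}}} :=
    to2 \o face_proj FF \o s \o sr_pi D.
  pose rhs : {rmorphism {mpoly k[n]} -> {poly {poly k}}} :=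
    comp_poly (to2 (face_proj FF (s (x_ j)))) \o map_poly (comp_poly (a *: 'X)) \o to2.
  apply: (@mpoly_rmorph_ext _ _ _ lhs rhs) => [b|l] /=.
    rewrite to2C map_polyC /= !comp_polyC -alg_mpolyC !linearZZ !rmorph1.
    by rewrite alg_mpolyC to2C.
  have [->|li] := eqVneq l i.
    rewrite -/(x_ i) six -mul_mpolyC rmorphM /= to2C to2i map_polyC /= comp_polyX comp_polyC.
    by rewrite -polyCM mul_polyC.
  have [->|lj] := eqVneq l j; first by rewrite to2j map_polyX comp_polyX.
  have /(vanish_face FF) -> : vanish F (s (x_ l)).
    by apply: sF; rewrite !finset.inE negb_or li.
  by rewrite /to2 /= mmapX mmap1U (negPf li) (negPf lj) mmap0 !raddf0.
have := sends_proj FF FF (s' (x_ j)) sF; rewrite s'K face_proj_var jF.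
move=> /(congr1 to2); rewrite comp_eq to2j => /esym /comp_poly_eqX[b [c [bU E]]].
move: bU; rewrite poly_unitE => /andP[/eqP sb _].
have bE : b = (b`_0)%:P by apply: size1_polyC; rewrite sb.
have [h [c0 cE]] : exists h c0, c = h * 'X + c0%:P.
  by elim/poly_ind: c {E} => [|h c0 _]; [exists 0, 0; rewrite mul0r addr0 | exists h, c0].
have {}E : face_proj FF (s (x_ j)) = b`_0 *: 'X_j + (horner_alg 'X_i h * 'X_i + c0%:MP).
  rewrite -to2K E bE cE /of2 /= rmorphD rmorphM /= !map_polyC map_polyX /= /horner_eval.
  rewrite hornerD hornerM !hornerC hornerX horner_algC alg_mpolyC mul_mpolyC.
  by rewrite coefC rmorphD rmorphM /= horner_algX horner_algC alg_mpolyC.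
have divXi : forall m : 'X_{1..n}, m i = 0%N -> (horner_alg 'X_i h * 'X_i : {mpoly k[n]})@_m = 0.
  by apply/mpoly_divX; exists (horner_alg 'X_i h).
have Uji : U_(j)%MM i = 0%N by rewrite mnm1E eq_sym (negPf ij).
have U0 : (U_(j) == 0 :> 'X_{1..n})%MM = false by apply/eqP => /mnmP/(_ j); rewrite mnm1E mnm0E eqxx.
have bj : scaling s j = b`_0.
  rewrite /scaling -(coef_face_proj FF) // E !mcoeffD mcoeffZ mcoeffX mcoeffC eqxx divXi //.
  by rewrite U0 mulr0 mulr1 !addr0.
have c00 : c0 = 0.
  have : (face_proj FF (s (x_ j)))@_0 = 0.
    rewrite mcoeff_face_proj s0 ?if_same //.
    by apply/fintype.subsetP => l; rewrite finset.inE mnm0E.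
  rewrite E !mcoeffD mcoeffZ mcoeffX mcoeffC divXi ?mnm0E // U0.
  by rewrite mulr0 !add0r eqxx mulr1.
exists h; apply/(vanishB FF); rewrite E c00 raddfD /= (linearZZ (face_proj FF)) /= rmorphM /=.
by rewrite lrmorph_horner_alg /= !face_proj_var iF jF bj addr0 mulrC.
Qed.

Hypothesis facets_preserved : forall F, facet D F -> matches s s' F F.

Lemma vertex_facet i : exists2 F, facet D F & i \in F.
Proof.
have [F FD iF] := face_facet (faces1 D i); exists F => //.
by rewrite -finset.sub1set.
Qed.

Lemma preserved_scaling i :
  (forall F, facet D F -> i \in F -> matches s s' (F :\ i)%SET (F :\ i)%SET) ->
  scaling s i != 0 /\ s (x_ i) = scaling s i *: x_ i.
Proof.
move=> hyp; have [F0 F0D iF0] := vertex_facet i; split.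
  have [//] := preserved_hyperplane (facet_face F0D) iF0 (facets_preserved F0D) (hyp _ F0D iF0).
apply/eqP; rewrite -subr_eq0; apply/eqP/vanish_eq0 => F FD; have FF := facet_face FD.
have [iF|iF] := boolP (i \in F).
  by have [] := preserved_hyperplane FF iF (facets_preserved FD) (hyp _ FD iF).
apply/(vanishB FF); rewrite (linearZZ (face_proj FF)) /= face_proj_var (negPf iF) scaler0.
by apply/(vanish_face FF); have [+ _] := facets_preserved FD; apply.
Qed.

(** The link of [i] being the single vertex [j], only the plane of [x_i] and
    [x_j] can carry a nonlinear part of the image of [x_j]. *)
Lemma preserved_shear i j a : i != j -> facet D [set i; j]%SET ->
  (forall F, facet D F -> i \in F -> F = [set i; j]%SET) ->
  s (x_ i) = a *: x_ i -> matches s s' finset.set0 finset.set0 ->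
  (forall F, facet D F -> j \in F -> i \notin F ->
     matches s s' (F :\ j)%SET (F :\ j)%SET) ->
  exists h, s (x_ j) = scaling s j *: x_ j + x_ i * horner_alg (x_ i) h.
Proof.
move=> ij ijD onlyF six m0 hyp; have FijD := facet_face ijD.
have [] := @preserved_plane i j a ij FijD (facets_preserved ijD).
- by rewrite six subrr => m _; rewrite -(raddf0 (sr_pi D)) sr_coef_pi mcoeff0 if_same.
- by have [+ _] := m0; apply; rewrite finset.inE.
move=> h hE; exists h; apply/eqP; rewrite -subr_eq0; apply/eqP/vanish_eq0 => F FD.
have [iF|iF] := boolP (i \in F); first by rewrite (onlyF F).
have FF := facet_face FD; apply/(vanishB FF).
have shear0 : face_proj FF (x_ i * horner_alg (x_ i) h) = 0.
  by rewrite (rmorphM (face_proj FF)) /= face_proj_var (negPf iF) mul0r.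
rewrite raddfD /= shear0 addr0.
have [jF|jF] := boolP (j \in F).
  apply/(vanishB FF).
  by have [] := preserved_hyperplane FF jF (facets_preserved FD) (hyp _ FD jF iF).
rewrite (linearZZ (face_proj FF)) /= face_proj_var (negPf jF) scaler0.
by apply/(vanish_face FF); have [+ _] := facets_preserved FD; apply.
Qed.

End PreservedFaces.

(** * The shears *)

Section Endomorphisms.
Variables (k : fieldType) (n : nat) (D : complex n).
Local Notation R := (sr_ring k D).
Local Notation x_ := (sr_var k D).

Definition sr_end (v : 'I_n -> R) (hv : kills_nonfaces D v) : R -> R :=
  sr_eval (GRing.in_alg R) hv.
HB.instance Definition _ v hv := GRing.RMorphism.on (@sr_end v hv).
Fact sr_end_is_scalable v hv : scalable (@sr_end v hv).
Proof. by move=> a f; rewrite /sr_end sr_evalZ /= mulr_algl. Qed.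
HB.instance Definition _ v hv :=
  GRing.isScalable.Build k R R *:%R (@sr_end v hv) (sr_end_is_scalable hv).

Lemma sr_end_var v hv i : @sr_end v hv (x_ i) = v i.
Proof. exact: sr_eval_var. Qed.

Lemma sr_aut_exists (v w : 'I_n -> R) (hv : kills_nonfaces D v) (hw : kills_nonfaces D w) :
  (forall i, sr_end hv (w i) = x_ i) -> (forall i, sr_end hw (v i) = x_ i) ->
  exists s : alg_aut R, forall i, s (x_ i) = v i.
Proof.
move=> vw wv.
have wK : cancel (sr_end hw) (sr_end hv).
  apply: (@sr_lrmorph_ext _ _ _ _ (sr_end hv \o sr_end hw) idfun) => i /=.
  by rewrite sr_end_var.
have vK : cancel (sr_end hv) (sr_end hw).
  apply: (@sr_lrmorph_ext _ _ _ _ (sr_end hw \o sr_end hv) idfun) => i /=.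
  by rewrite sr_end_var.
have lin : linear (sr_end hv) by move=> a f g; rewrite linearP.
have mon : monoid_morphism (sr_end hv).
  by split=> [|f g]; [exact: rmorph1 | exact: rmorphM].
by exists (AlgAut vK wK lin mon) => i; apply: sr_end_var.
Qed.

End Endomorphisms.

Lemma vtx_eq a b : (a.-1 < 5)%N -> (b.-1 < 5)%N -> (vtx a == vtx b) = (a.-1 == b.-1).
Proof. by move=> a5 b5; rewrite -val_eqE /= !inordK. Qed.

Lemma vtxP (P : 'I_5 -> Prop) :
  P (vtx 1) -> P (vtx 2) -> P (vtx 3) -> P (vtx 4) -> P (vtx 5) -> forall i, P i.
Proof.
move=> P1 P2 P3 P4 P5 [i i5]; have -> : Ordinal i5 = vtx i.+1.
  by apply/val_inj; rewrite /= inordK.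
by case: i i5 => [|[|[|[|[|]]]]].
Qed.

Lemma horner_algZ (k : fieldType) (A : comAlgType k) (x : A) a (p : {poly k}) :
  horner_alg x (a *: p) = a *: horner_alg x p.
Proof. by rewrite -mul_polyC rmorphM /= horner_algC mulr_algl. Qed.

Lemma horner_alg_scaled (k : fieldType) (A : comAlgType k) (x : A) a (p : {poly k}) :
  horner_alg (a *: x) p = horner_alg x (p \Po (a *: 'X)).
Proof.
elim/poly_ind: p => [|p c IHp]; first by rewrite comp_poly0 !raddf0.
rewrite comp_polyD comp_polyM comp_polyX comp_polyC !rmorphD !rmorphM /= IHp.
by rewrite horner_algZ !horner_algX !horner_algC.
Qed.

Section Shears.
Variables (k : fieldType) (D : complex 5).
Local Notation R := (sr_ring k D).
Local Notation x_ := (sr_var k D).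
Implicit Types (t : 'I_5 -> k) (h g : {poly k}).

Definition phi_img t h g (i : 'I_5) : R :=
  t i *: x_ i + (if i == vtx 2 then x_ (vtx 1) * horner_alg (x_ (vtx 1)) h
                 else if i == vtx 4 then x_ (vtx 5) * horner_alg (x_ (vtx 5)) g else 0).

Lemma phi_formulaE t h g (s : alg_aut R) :
  phi_formula t h g s <-> forall i, s (x_ i) = phi_img t h g i.
Proof.
split=> [[s1 s2 s3 s4 s5]|sE].
  by apply: vtxP; rewrite /phi_img !vtx_eq //= ?addr0.
by split; rewrite sE /phi_img !vtx_eq //= ?addr0.
Qed.

(** The nonlinear part of a composite of two shears of [x_j] by multiples of [x_i]:
    the outer one scales [x_i] by [a], the inner one scales [x_j] by [b]. *)
Definition phi_comp (a : k) (b : k) (h h' : {poly k}) : {poly k} :=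
  b *: h + a *: (h' \Po (a *: 'X)).

Lemma phi_img_comp (s : {lrmorphism R -> R}) t h g t' h' g' i :
  (forall i, s (x_ i) = phi_img t h g i) ->
  s (phi_img t' h' g' i) =
  phi_img (fun i => t i * t' i) (phi_comp (t (vtx 1)) (t' (vtx 2)) h h')
    (phi_comp (t (vtx 5)) (t' (vtx 4)) g g') i.
Proof.
move=> sE; have s1 : s (x_ (vtx 1)) = t (vtx 1) *: x_ (vtx 1).
  by rewrite sE /phi_img !vtx_eq //= addr0.
have s5 : s (x_ (vtx 5)) = t (vtx 5) *: x_ (vtx 5).
  by rewrite sE /phi_img !vtx_eq //= addr0.
have shear j a b (h1 h2 : {poly k}) :
  b *: (x_ j * horner_alg (x_ j) h1) + a *: x_ j * horner_alg (a *: x_ j) h2 =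
  x_ j * horner_alg (x_ j) (phi_comp a b h1 h2).
  rewrite horner_alg_scaled /phi_comp raddfD /= !horner_algZ.
  by rewrite mulrDr -!scalerAr -scalerAl.
rewrite /phi_img raddfD /= (linearZZ s) /= sE /phi_img scalerDr scalerA mulrC -addrA.
congr (_ + _); case: eqP => [->|_].
  by rewrite rmorphM /= lrmorph_horner_alg s1 shear.
case: eqP => [->|_]; last by rewrite scaler0 raddf0 addr0.
by rewrite rmorphM /= lrmorph_horner_alg s5 shear.
Qed.

Lemma phi_img1 t i : (forall i, t i = 1) -> phi_img t 0 0 i = x_ i.
Proof. by move=> t1; rewrite /phi_img t1 scale1r !raddf0 !mulr0 !if_same addr0. Qed.

(** The star of [a] is a cone over [b]; this is what allows adding multiples of
    [x_a] to [x_b]. *)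
Definition dominated (a b : 'I_5) : Prop := forall F, facet D F -> a \in F -> b \in F.

Hypotheses (dom1 : dominated (vtx 1) (vtx 2)) (dom5 : dominated (vtx 5) (vtx 4)).

Lemma phi_img_vanish t h g F i : facet D F -> i \notin F -> vanish F (phi_img t h g i).
Proof.
move=> FD iF; have FF := facet_face FD; apply/(vanish_face FF).
have out j : j \notin F -> face_proj FF (x_ j) = 0.
  by move=> jF; rewrite face_proj_var (negPf jF).
rewrite /phi_img raddfD /= (linearZZ (face_proj FF)) /= out // scaler0 add0r.
case: eqP => [i2|_]; first by rewrite rmorphM /= out ?mul0r //; apply: contra iF; rewrite i2; apply: dom1.
case: eqP => [i4|_]; last exact: raddf0.
by rewrite rmorphM /= out ?mul0r //; apply: contra iF; rewrite i4; apply: dom5.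
Qed.

Lemma phi_img_kills t h g : kills_nonfaces D (phi_img t h g).
Proof. by apply: kills_nonfaces_facets => F FD i; apply: phi_img_vanish. Qed.

(** The solution [h'] of [phi_comp a b^-1 h h' = 0]. *)
Definition phi_inv (a b : k) (h : {poly k}) : {poly k} :=
  - (a * b)^-1 *: (h \Po (a^-1 *: 'X)).

Lemma phi_comp_inv a b h : a != 0 -> b != 0 -> phi_comp a b^-1 h (phi_inv a b h) = 0.
Proof.
move=> a0 b0; rewrite /phi_comp /phi_inv comp_polyZ -comp_polyA comp_polyZ comp_polyX.
rewrite (scalerA a^-1) mulVf // scale1r comp_polyXr scalerA mulrN invfM mulrA divff // mul1r.
by rewrite scaleNr subrr.
Qed.

Lemma phi_inv_comp a b h : a != 0 -> b != 0 -> phi_comp a^-1 b (phi_inv a b h) h = 0.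
Proof.
move=> a0 b0; rewrite /phi_comp /phi_inv scalerA mulrN invfM mulrCA divff // mulr1.
by rewrite scaleNr addNr.
Qed.

Lemma phi_exists t h g : (forall i, t i != 0) ->
  exists s : alg_aut R, phi_formula t h g s.
Proof.
move=> t0.
pose h' := phi_inv (t (vtx 1)) (t (vtx 2)) h; pose g' := phi_inv (t (vtx 5)) (t (vtx 4)) g.
have [|i|s sE] := @sr_aut_exists _ _ D _ _ (phi_img_kills t h g)
    (phi_img_kills (fun i => (t i)^-1) h' g') => [i||].
- rewrite (phi_img_comp _ _ _ _ (sr_end_var _)) !phi_comp_inv // phi_img1 // => j.
  exact: divff.
- rewrite (phi_img_comp _ _ _ _ (sr_end_var _)) !phi_inv_comp // phi_img1 // => j.
  exact: mulVf.
by exists s; apply/phi_formulaE.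
Qed.

End Shears.

(** * Facets of the two complexes *)

Lemma facet_generated n (Fs : seq {set 'I_n}) (i0 : 'I_n)
    (cover : forall i, has (fun F : {set 'I_n} => i \in F) Fs) :
  (forall F G, F \in Fs -> G \in Fs -> F \subset G -> G = F) ->
  facet (generated_complex i0 cover) =i Fs.
Proof.
move=> anti F; rewrite -[F \in facet _]/(facet _ F); apply/idP/idP => [FD|FFs].
  have := facet_face FD; rewrite /= finset.inE => /hasP[G GFs FG].
  rewrite -(facet_max FD _ FG) // /= finset.inE; apply/hasP; by exists G.
rewrite /facet /= finset.inE; apply/andP; split; first by apply/hasP; exists F.
apply/forallP => S; apply/implyP; rewrite finset.inE => /hasP[G GFs SG].
apply/implyP => FS; rewrite finset.eqEsubset FS andbT.
by rewrite -(anti F G FFs GFs (fintype.subset_trans FS SG)).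
Qed.

Lemma set5_neq0 (A : {set 'I_5}) : (A != finset.set0) =
  [|| vtx 1 \in A, vtx 2 \in A, vtx 3 \in A, vtx 4 \in A | vtx 5 \in A].
Proof.
apply/set0Pn/idP => [[i]|].
  by move: i; apply: vtxP => ->; rewrite ?orbT.
by case/or4P=> [H|H|H|/orP[H|H]]; eexists; apply: H.
Qed.

Lemma set5_sub (A B : {set 'I_5}) : (A \subset B) =
  [&& (vtx 1 \in A) ==> (vtx 1 \in B), (vtx 2 \in A) ==> (vtx 2 \in B),
      (vtx 3 \in A) ==> (vtx 3 \in B), (vtx 4 \in A) ==> (vtx 4 \in B) &
      (vtx 5 \in A) ==> (vtx 5 \in B)].
Proof.
apply/fintype.subsetP/idP => [AB|].
  by rewrite !(introT implyP (AB _)).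
by case/and5P=> ? ? ? ? ? i; move: i; apply: vtxP; apply/implyP.
Qed.

Lemma set5_eq (A B : {set 'I_5}) : (A == B) =
  [&& (vtx 1 \in A) == (vtx 1 \in B), (vtx 2 \in A) == (vtx 2 \in B),
      (vtx 3 \in A) == (vtx 3 \in B), (vtx 4 \in A) == (vtx 4 \in B) &
      (vtx 5 \in A) == (vtx 5 \in B)].
Proof.
apply/eqP/idP => [->|]; first by rewrite !eqxx.
by case/and5P=> ? ? ? ? ?; apply/setP; apply: vtxP; apply/eqP.
Qed.

(** A boolean index lets both complexes share one proof. *)
Definition facets12 (b : bool) : seq {set 'I_5} := if b then facets1 else facets2.
Definition Delta12 (b : bool) : complex 5 := if b then Delta1 else Delta2.

Lemma facet_Delta b : facet (Delta12 b) =i facets12 b.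
Proof.
by case: b; apply: facet_generated => F G; rewrite !inE => /or4P[] /eqP-> /or4P[] /eqP->;
  rewrite ?set5_sub !inE !vtx_eq.
Qed.

Lemma uniq_facets b : uniq (facets12 b).
Proof.
by case: b; rewrite /= !inE !set5_eq !inE !vtx_eq.
Qed.

(** * Symmetries of the intersection graphs *)

Lemma pi_vtx a : (0 < a < 6)%N -> pi_perm (vtx a) = vtx (6 - a).
Proof.
by case: a => [|[|[|[|[|[|a]]]]]] //= _; rewrite /pi_perm permM !permE /= !vtx_eq //= ?permE /= ?vtx_eq.
Qed.

Lemma pi_permK : involutive pi_perm.
Proof. by apply: vtxP; rewrite !pi_vtx. Qed.

Lemma in_pi_imset (A : {set 'I_5}) i : (i \in pi_perm @: A)%SET = (pi_perm i \in A).
Proof. by rewrite -[in LHS](pi_permK i) mem_imset //; apply: perm_inj. Qed.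

Lemma pi_imsetK (A : {set 'I_5}) : (pi_perm @: (pi_perm @: A) = A)%SET.
Proof. by apply/setP => i; rewrite !in_pi_imset pi_permK. Qed.

(** The action of [pi] on the positions in [facets12 b]. *)
Definition mirror (b : bool) (i : nat) : nat :=
  if b then (3 - i)%N else if (i < 3)%N then (2 - i)%N else i.

(** Whether two facets meet, in terms of their positions: a path in the first
    complex, a path and an isolated point in the second. *)
Definition near (b : bool) (i j : nat) : bool :=
  if b then (i <= j.+1)%N && (j <= i.+1)%N
  else (i == j) || [&& (i < 3)%N, (j < 3)%N, (i <= j.+1)%N & (j <= i.+1)%N].

Local Notation facet_ b i := (nth finset.set0 (facets12 b) i).

Lemma facet_mirror b i : (i < 4)%N -> (pi_perm @: facet_ b i)%SET = facet_ b (mirror b i).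
Proof.
by case: b; case: i => [|[|[|[|]]]] // _; apply/setP; apply: vtxP;
  rewrite in_pi_imset pi_vtx // !inE !vtx_eq.
Qed.

Lemma facets_near b i j : (i < 4)%N -> (j < 4)%N ->
  (facet_ b i :&: facet_ b j == finset.set0)%SET = ~~ near b i j.
Proof.
rewrite -[LHS]negbK set5_neq0; case: b; case: i => [|[|[|[|]]]] //; case: j => [|[|[|[|]]]] // _ _;
  by rewrite !inE !vtx_eq.
Qed.

Definition near_embedding (b b' : bool) (l : seq nat) : bool :=
  uniq l && all (fun i => all (fun j =>
    near b' i j == near b (nth 0%N l i) (nth 0%N l j)) (iota 0 4)) (iota 0 4).

(** By enumeration: a path on four points has one nontrivial symmetry, so has a path
    on three points with an isolated point, and the two graphs differ. *)
Lemma near_embeddings b b' (l : seq nat) : size l = 4 -> all (fun a => a < 4)%N l ->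
  near_embedding b b' l ->
  (b == b') && ((l == iota 0 4) || (l == [seq mirror b i | i <- iota 0 4])).
Proof.
have check : all (fun b => all (fun b' => all (fun a0 => all (fun a1 => all (fun a2 =>
    all (fun a3 => let l := [:: a0; a1; a2; a3] in near_embedding b b' l ==>
      (b == b') && ((l == iota 0 4) || (l == [seq mirror b i | i <- iota 0 4])))
    (iota 0 4)) (iota 0 4)) (iota 0 4)) (iota 0 4)) [:: true; false]) [:: true; false].
  by vm_compute.
have inb (c : bool) : c \in [:: true; false] by case: c.
case: l => [|a0 [|a1 [|a2 [|a3 [|]]]]] //= _ /and5P[h0 h1 h2 h3 _] emb.
move/allP/(_ b (inb b))/allP/(_ b' (inb b')): check.
have in4 a : (a < 4)%N -> a \in iota 0 4 by rewrite mem_iota.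
move=> /allP/(_ a0 (in4 _ h0))/allP/(_ a1 (in4 _ h1))/allP/(_ a2 (in4 _ h2)).
by move=> /allP/(_ a3 (in4 _ h3))/implyP/(_ emb).
Qed.

Lemma Delta_matching (k : fieldType) b b'
    (s : {lrmorphism sr_ring k (Delta12 b) -> sr_ring k (Delta12 b')})
    (s' : {lrmorphism sr_ring k (Delta12 b') -> sr_ring k (Delta12 b)}) :
  cancel s s' -> cancel s' s ->
  b = b' /\
  ((forall i, (i < 4)%N -> matches s s' (facet_ b' i) (facet_ b i)) \/
   (forall i, (i < 4)%N -> matches s s' (facet_ b' i) (facet_ b (mirror b i)))).
Proof.
move=> sK s'K; have sz c : size (facets12 c) = 4 by case: c.
have [l [sl ul al ml nl]] := matching_of_facets sK s'K (facet_Delta b) (facet_Delta b') (uniq_facets b').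
rewrite !sz in sl al ml nl.
have lt4 i : (i < 4)%N -> (nth 0%N l i < 4)%N.
  by move=> i4; apply: (allP al); rewrite mem_nth // sl.
have : near_embedding b b' l.
  rewrite /near_embedding ul andTb; apply/allP => i; rewrite mem_iota => i4.
  apply/allP => j; rewrite mem_iota => j4; apply/eqP/negb_inj.
  by rewrite -!facets_near ?lt4 // nl.
move=> /(near_embeddings sl al)/andP[/eqP bb' lE]; split=> //.
case/orP: lE => /eqP lE; [left|right] => i i4; have := ml i i4; rewrite lE.
  by rewrite nth_iota.
by rewrite (nth_map 0%N) ?size_iota // nth_iota.
Qed.

(** * The automorphism group as a semidirect product *)

Section DeltaAut.
Variables (k : fieldType).
Local Notation facet_ b i := (nth finset.set0 (facets12 b) i).
Local Notation R b := (sr_ring k (Delta12 b)).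
Local Notation x_ b := (sr_var k (Delta12 b)).
Local Notation matches_ s := (matches (aut_fun s) (aut_fun (s^-1)%g)).

Lemma facet_DeltaP b F : facet (Delta12 b) F -> exists2 i, (i < 4)%N & F = facet_ b i.
Proof.
rewrite -[facet _ _]/(F \in facet _) facet_Delta => FF.
exists (index F (facets12 b)); last by rewrite nth_index.
have : (index F (facets12 b) < size (facets12 b))%N by rewrite index_mem.
by case: b {FF}.
Qed.

Lemma facet_nth b i : (i < 4)%N -> facet (Delta12 b) (facet_ b i).
Proof.
move=> i4; rewrite -[facet _ _]/(facet_ b i \in facet _) facet_Delta mem_nth //.
by case: (b).
Qed.

Lemma Delta_dominated b : dominated (Delta12 b) (vtx 1) (vtx 2) /\
  dominated (Delta12 b) (vtx 5) (vtx 4).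
Proof.
by split=> F /facet_DeltaP[[|[|[|[|]]]] // _ ->]; case: b; rewrite !inE !vtx_eq.
Qed.

(** Components are matched with unique partners, so an inclusion suffices. *)
Lemma matches_fixed n (D : complex n) (s : alg_aut (sr_ring k D)) F :
  facet D F -> sends s F F -> matches (aut_fun s) (aut_fun (s^-1)%g) F F.
Proof.
move=> FD sF; have FF := facet_face FD.
have [F' F'D m] := matches_facet (s := s) (s' := aut_fun (s^-1)%g) (aut_invK s) FD.
suff E : F = F' by rewrite {2}E.
apply: (facet_max F'D) => //; apply: (@sends_id k n D) => i iF.
have [_ sV] := m.
by have := sends_comp (facet_face F'D) FF sV sF iF; rewrite /= aut_funK.
Qed.

(** The coordinate hyperplanes of the components are intersections of components,
    apart from the axes of [x_1] and [x_5], each of which lies in one component. *)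
Lemma facet_minus_vertex b F i : facet (Delta12 b) F -> i \in F ->
  (i == vtx 2) ==> (vtx 1 \notin F) -> (i == vtx 4) ==> (vtx 5 \notin F) ->
  [|| F :\ i == finset.set0, F :\ i == [set vtx 2], F :\ i == [set vtx 4] |
      b && (F :\ i == [set vtx 3])]%SET.
Proof.
move=> /facet_DeltaP[a a4 ->]; move: i; apply: vtxP;
  case: b; case: a a4 => [|[|[|[|]]]] // _; rewrite !inE !vtx_eq //= => _ _ _;
  by rewrite !set5_eq !inE !vtx_eq.
Qed.

Definition fixes_facets b (s : alg_aut (R b)) : Prop :=
  forall F, facet (Delta12 b) F -> sends s F F.

(** Preserving the components forces preserving the origin and the axes of [x_2] and
    [x_4], and these bound what [s] does to each variable on each component. *)
Lemma fixes_facets_phi b (s : alg_aut (R b)) : fixes_facets s <-> phi_set s.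
Proof.
split=> [fs|[t [h [g [t0 /phi_formulaE sE]]]] F FD i iF]; last first.
  by rewrite sE; apply: phi_img_vanish => //; have [] := Delta_dominated b.
have mF F : facet (Delta12 b) F -> matches_ s F F.
  by move=> FD; apply: matches_fixed => //; apply: fs.
have m2 : matches_ s [set vtx 2]%SET [set vtx 2]%SET.
  have -> : [set vtx 2]%SET = (facet_ b 0 :&: facet_ b 1)%SET.
    by apply/setP; apply: vtxP; case: (b); rewrite !inE !vtx_eq.
  by apply: matchesI; apply/mF/facet_nth.
have m4 : matches_ s [set vtx 4]%SET [set vtx 4]%SET.
  have -> : [set vtx 4]%SET = (facet_ b 2 :&: facet_ b (if b then 3 else 1%N))%SET.
    by apply/setP; apply: vtxP; case: (b); rewrite !inE !vtx_eq.
  by apply: matchesI; apply/mF/facet_nth => //; case: (b).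
have m0 : matches_ s finset.set0 finset.set0.
  have -> : finset.set0 = (facet_ b 0 :&: facet_ b 3)%SET.
    by apply/setP; apply: vtxP; case: (b); rewrite !inE !vtx_eq.
  by apply: matchesI; apply/mF/facet_nth.
have m3 : b -> matches_ s [set vtx 3]%SET [set vtx 3]%SET.
  case: (b) s mF {fs m2 m4 m0} => // s mF _.
  have -> : [set vtx 3]%SET = (facet_ true 1 :&: facet_ true 2)%SET.
    by apply/setP; apply: vtxP; rewrite !inE !vtx_eq.
  by apply: matchesI; apply/mF/facet_nth.
have hyp F i : facet (Delta12 b) F -> i \in F ->
    (i == vtx 2) ==> (vtx 1 \notin F) -> (i == vtx 4) ==> (vtx 5 \notin F) ->
    matches_ s (F :\ i)%SET (F :\ i)%SET.
  move=> FD iF i2 i4; have := facet_minus_vertex FD iF i2 i4.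
  by case/or4P=> [/eqP->|/eqP->|/eqP->|/andP[bT /eqP->]] //; apply: m3.
have s'K : cancel (aut_fun (s^-1)%g) s := aut_invK s.
have scal i : i != vtx 2 -> i != vtx 4 -> scaling s i != 0 /\ s (x_ b i) = scaling s i *: x_ b i.
  move=> /negPf i2 /negPf i4; apply: (preserved_scaling s'K mF) => F FD iF.
  by apply: hyp; rewrite ?i2 ?i4.
have middle j F i : facet (Delta12 b) F -> j \in F -> i \notin F ->
    (j == vtx 2) ==> (i == vtx 1) -> (j == vtx 4) ==> (i == vtx 5) ->
    matches_ s (F :\ j)%SET (F :\ j)%SET.
  move=> FD jF iF /implyP j2 /implyP j4; apply: hyp => //; apply/implyP.
    by move=> /j2/eqP <-.
  by move=> /j4/eqP <-.
have nz2 : scaling s (vtx 2) != 0.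
  have FD : facet (Delta12 b) (facet_ b 1) by apply: facet_nth.
  have v2 : vtx 2 \in facet_ b 1 by case: (b); rewrite !inE !vtx_eq.
  have [//|//] := preserved_hyperplane s'K (facet_face FD) v2 (mF _ FD).
  by apply: (middle _ _ (vtx 1)); rewrite ?vtx_eq //; case: (b); rewrite !inE !vtx_eq.
have nz4 : scaling s (vtx 4) != 0.
  pose a := if b then 2%N else 1%N.
  have FD : facet (Delta12 b) (facet_ b a) by apply: facet_nth; rewrite /a; case: (b).
  have v4 : vtx 4 \in facet_ b a by rewrite /a; case: (b); rewrite !inE !vtx_eq.
  have [//|//] := preserved_hyperplane s'K (facet_face FD) v4 (mF _ FD).
  by apply: (middle _ _ (vtx 5)); rewrite ?vtx_eq // /a; case: (b); rewrite !inE !vtx_eq.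
have [||nz1 s1] := scal (vtx 1); [by rewrite vtx_eq|by rewrite vtx_eq|].
have [||nz3 s3] := scal (vtx 3); [by rewrite vtx_eq|by rewrite vtx_eq|].
have [||nz5 s5] := scal (vtx 5); [by rewrite vtx_eq|by rewrite vtx_eq|].
have shear i j : i != j -> facet (Delta12 b) [set i; j]%SET ->
    (forall F, facet (Delta12 b) F -> i \in F -> F = [set i; j]%SET) ->
    s (x_ b i) = scaling s i *: x_ b i ->
    (j == vtx 2) ==> (i == vtx 1) -> (j == vtx 4) ==> (i == vtx 5) ->
    exists h, s (x_ b j) = scaling s j *: x_ b j + x_ b i * horner_alg (x_ b i) h.
  move=> ij ijD onlyF si j2 j4; apply: (preserved_shear s'K mF ij ijD onlyF si m0).
  by move=> F FD jF iF; apply: (middle _ _ i).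
have [|||||h s2] := @shear (vtx 1) (vtx 2) _ _ _ s1; rewrite ?vtx_eq //.
- by have := @facet_nth b 0 isT; case: (b).
- move=> F /facet_DeltaP[a a4 ->].
  by case: (b); case: a a4 => [|[|[|[|]]]] // _; rewrite !inE !vtx_eq.
have [|||||g s4] := @shear (vtx 5) (vtx 4) _ _ _ s5; rewrite ?vtx_eq //.
- have -> : [set vtx 5; vtx 4]%SET = facet_ b (if b then 3 else 2%N).
    by case: (b); rewrite finset.setUC.
  by apply: facet_nth; case: (b).
- move=> F /facet_DeltaP[a a4 ->]; rewrite finset.setUC.
  by case: (b); case: a a4 => [|[|[|[|]]]] // _; rewrite !inE !vtx_eq.
exists (scaling s), h, g; split; last by split.
exact: vtxP.
Qed.

Lemma pi_faces b S : S \in faces (Delta12 b) -> (pi_perm @: S)%SET \in faces (Delta12 b).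
Proof.
move=> /face_facet[F /facet_DeltaP[a a4 ->] SF]; apply: faces_sub (imsetS _ SF) _.
rewrite facet_mirror //; apply/facet_face/facet_nth.
by case: (b); case: a a4 {SF} => [|[|[|[|]]]].
Qed.

Lemma pi_kills b : kills_nonfaces (Delta12 b) (fun i => x_ b (pi_perm i)).
Proof.
move=> S SD; rewrite -(big_imset (fun j => x_ b j)) /=; last by move=> i j _ _; apply: perm_inj.
apply: prod_nonface; apply: contra SD => /pi_faces.
by rewrite pi_imsetK.
Qed.

Lemma reflection_exists b : exists tau : alg_aut (R b), forall i, tau (x_ b i) = x_ b (pi_perm i).
Proof.
have tauK i : sr_end (@pi_kills b) (x_ b (pi_perm i)) = x_ b i.
  by rewrite sr_end_var pi_permK.
exact: (sr_aut_exists tauK tauK).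
Qed.

Section Reflection.
Variables (b : bool) (tau : alg_aut (R b)).
Hypothesis tauE : forall i, tau (x_ b i) = x_ b (pi_perm i).

Lemma reflection_sq : (tau * tau = 1)%g.
Proof. by apply: var_coef_ext => i; rewrite !aut_mulE !tauE pi_permK aut_1E. Qed.

Lemma reflection_sends (F : {set 'I_5}) : sends tau (pi_perm @: F)%SET F.
Proof.
move=> i iF; rewrite tauE; apply/vanish_var.
by rewrite in_pi_imset pi_permK.
Qed.

Lemma reflection_phi t h g i :
  tau (phi_img _ t h g i) = phi_img _ (fun j => t (pi_perm j)) g h (pi_perm i).
Proof.
have pi_eq a c : (0 < c < 6)%N -> (pi_perm a == vtx (6 - c)) = (a == vtx c).
  by move=> c6; rewrite -pi_vtx // (inj_eq perm_inj).
rewrite /phi_img raddfD /= (linearZZ tau) /= tauE pi_permK; congr (_ + _).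
have tau_shear a q : (0 < a < 6)%N -> tau (x_ b (vtx a) * horner_alg (x_ b (vtx a)) q) =
    x_ b (vtx (6 - a)) * horner_alg (x_ b (vtx (6 - a))) q.
  by move=> a6; rewrite (rmorphM tau) /= lrmorph_horner_alg /= tauE pi_vtx.
rewrite (pi_eq _ 4%N) // (pi_eq _ 2%N) //.
case: eqP => [->|_]; first by rewrite tau_shear // vtx_eq.
by case: eqP => _; rewrite ?raddf0 // tau_shear.
Qed.

Lemma fixes_or_flips (s : alg_aut (R b)) : phi_set s \/ phi_set (s * tau)%g.
Proof.
have [_ [fixed|flip]] := Delta_matching (s := aut_fun s) (s' := aut_fun (s^-1)%g)
  (aut_funK s) (aut_invK s); [left|right]; apply/fixes_facets_phi => F /facet_DeltaP[a a4 ->].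
  by have [] := fixed a a4.
have [sF _] := flip a a4; rewrite -facet_mirror // in sF.
apply: (sends_comp (facet_face (facet_nth b a4)) _ sF).
  by apply/pi_faces/facet_face/facet_nth.
exact: reflection_sends.
Qed.

Lemma phi_set_subgroup : subgroup (@phi_set k (Delta12 b)).
Proof.
split=> [|x y]; rewrite -!fixes_facets_phi; first by move=> F FD i iF; apply/vanish_var.
move=> fx fy F FD; have FF := facet_face FD.
have [_ sy] := matches_fixed FD (fy F FD).
exact: (sends_comp FF FF (fx F FD) sy).
Qed.

Lemma phi_set_normal (x g : alg_aut (R b)) : phi_set x -> phi_set (g * x * g^-1)%g.
Proof.
rewrite -!fixes_facets_phi => fx F FD; have FF := facet_face FD.
have [F' F'D [gF g'F]] := matches_facet (s := aut_fun g) (s' := aut_fun (g^-1)%g) (aut_invK g) FD.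
have FF' := facet_face F'D.
exact: (sends_comp FF FF' (sends_comp FF FF' gF (fx F' F'D)) g'F).
Qed.

Lemma cyclic_reflection x : cyclic_subgroup tau x <-> x = 1%g \/ x = tau.
Proof.
have tauV : (tau^-1 = tau)%g by apply: (mulgI tau); rewrite mulgV reflection_sq.
have pow m : (tau ^+ m = 1 \/ tau ^+ m = tau)%g.
  elim: m => [|m [IHm|IHm]]; [left|right|left]; rewrite ?expg0 // expgS IHm ?mulg1 //.
  exact: reflection_sq.
split=> [[m [->|->]]|[->|->]].
- exact: pow.
- by have [->|->] := pow m; [left; rewrite invg1|right].
- by exists 0%N; left; rewrite expg0.
by exists 1%N; left; rewrite expg1.
Qed.

Lemma reflection_notin_phi : ~ phi_set tau.
Proof.
move=> /fixes_facets_phi/(_ _ (facet_nth b (isT : 0 < 4)%N) (vtx 5)).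
rewrite tauE pi_vtx // => H; have /vanish_var : vanish (facet_ b 0) (x_ b (vtx 1)).
  by apply: H; case: (b); rewrite !inE !vtx_eq.
by case: (b); rewrite !inE !vtx_eq.
Qed.

Lemma Delta_semidirect : semidirect (@phi_set k (Delta12 b)) (cyclic_subgroup tau).
Proof.
split; [exact: phi_set_subgroup|exact: phi_set_normal| | |].
- split=> [|x y]; rewrite !cyclic_reflection; first by left.
  have tauV : (tau^-1 = tau)%g by apply: (mulgI tau); rewrite mulgV reflection_sq.
  by move=> [->|->] [->|->]; rewrite ?invg1 ?mulg1 ?tauV ?mul1g ?reflection_sq; auto.
- by move=> x Nx /cyclic_reflection[//|xE]; rewrite xE in Nx; case: (reflection_notin_phi Nx).
move=> s; have [Ns|Ns] := fixes_or_flips s.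
  by exists s, 1%g; split; rewrite ?mulg1 //; apply/cyclic_reflection; left.
exists (s * tau)%g, tau; split=> //; first by apply/cyclic_reflection; right.
by rewrite -mulgA reflection_sq mulg1.
Qed.

End Reflection.

End DeltaAut.

(** * Identifying the two ind-groups *)

Section Transport.
Variable k : fieldType.
Local Notation R b := (sr_ring k (Delta12 b)).
Local Notation x_ b := (sr_var k (Delta12 b)).

(** Powers of one variable are supported on a vertex, hence on a face of every
    complex. *)
Lemma coef_horner_var (i : 'I_5) (D : complex 5) (q : {poly k}) m :
  sr_coef m (horner_alg (sr_var k D i) q) = (horner_alg ('X_i : {mpoly k[5]}) q)@_m.
Proof.
have -> : horner_alg (sr_var k D i) q = sr_pi D (horner_alg 'X_i q).
  by rewrite (lrmorph_horner_alg (sr_pi D)).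
rewrite sr_coef_pi; case: ifP => // /negbT nFm.
rewrite -[q]coefK poly_def !raddf_sum big1 // => e _ /=.
rewrite horner_algZ rmorphXn /= horner_algX mpolyXn mcoeffZ mcoeffX.
case: eqP => [mE|]; last by rewrite mulr0.
case/negP: nFm; apply: (faces_sub _ (faces1 D i)); apply/fintype.subsetP => j.
by rewrite !inE -mE mulmnE mnm1E [j == i]eq_sym; case: (i == j); rewrite ?mul0n.
Qed.

Lemma coef_phi_img (D D' : complex 5) (t : 'I_5 -> k) h g i m :
  sr_coef m (phi_img D t h g i) = sr_coef m (phi_img D' t h g i).
Proof.
have cvar : sr_coef m (sr_var k D i) = sr_coef m (sr_var k D' i).
  by rewrite -[sr_var k D i]horner_algX -[sr_var k D' i]horner_algX !coef_horner_var.
have cshear j q : sr_coef m (sr_var k D j * horner_alg (sr_var k D j) q) =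
    sr_coef m (sr_var k D' j * horner_alg (sr_var k D' j) q).
  rewrite -{1}[sr_var k D j]horner_algX -{1}[sr_var k D' j]horner_algX -!rmorphM.
  by rewrite !coef_horner_var.
rewrite /phi_img !sr_coefD !sr_coefZ cvar; congr (_ + _).
case: eqP => _; first exact: cshear.
case: eqP => _; first exact: cshear.
by rewrite -(raddf0 (sr_pi D)) -(raddf0 (sr_pi D')) !sr_coef_pi mcoeff0 !if_same.
Qed.

(** The parameters of a shear, and whether it is composed with the reflection. *)
Definition params : Type := ('I_5 -> k) * {poly k} * {poly k} * bool.

Definition flip (e : bool) (i : 'I_5) : 'I_5 := if e then pi_perm i else i.

Definition has_params b (p : params) (s : alg_aut (R b)) : Prop :=
  let: (t, h, g, e) := p in
  (forall i, t i != 0) /\ forall i, s (x_ b i) = phi_img _ t h g (flip e i).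

Lemma params_of b (s : alg_aut (R b)) : exists p, has_params p s.
Proof.
have [tau tauE] := reflection_exists k b.
have [[t [h [g [t0 /phi_formulaE sE]]]]|[t [h [g [t0 /phi_formulaE sE]]]]] :=
    fixes_or_flips tauE s.
  by exists (t, h, g, false).
exists (t, h, g, true); split=> // i.
by rewrite /= -sE aut_mulE tauE pi_permK.
Qed.

Lemma aut_of_params b b' (s : alg_aut (R b)) p : has_params p s ->
  exists s' : alg_aut (R b'), has_params p s'.
Proof.
case: p => [[[t h] g] e] [t0 _].
have [dom1 dom5] := Delta_dominated b'.
have [s' /phi_formulaE s'E] := phi_exists dom1 dom5 h g t0.
have [tau tauE] := reflection_exists k b'.
exists (if e then (s' * tau)%g else s'); split=> // i.
by case: e => /=; rewrite ?aut_mulE ?tauE s'E.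
Qed.

(** One choice of [p''] serves both complexes; the reflection conjugates a shear by
    exchanging the roles of [h] and [g]. *)
Lemma params_mul p p' : exists p'', forall b (s s' : alg_aut (R b)),
  has_params p s -> has_params p' s' -> has_params p'' (s * s')%g.
Proof.
case: p p' => [[[t h] g] e] [[[t' h'] g'] e'].
pose t2 i := t' (flip e i); pose h2 := if e then g' else h'; pose g2 := if e then h' else g'.
exists (fun i => t i * t2 i, phi_comp (t (vtx 1)) (t2 (vtx 2)) h h2,
   phi_comp (t (vtx 5)) (t2 (vtx 4)) g g2, e (+) e').
move=> b s s' [t0 sE] [t'0 s'E]; split=> [i|i]; first by rewrite mulf_neq0 // /t2.
rewrite aut_mulE s'E; case: e @t2 @h2 @g2 sE => /= sE; last first.
  by rewrite (phi_img_comp _ _ _ _ sE).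
have [tau tauE] := reflection_exists k b.
pose r := (s * tau)%g; have rE j : r (x_ b j) = phi_img _ t h g j.
  by rewrite aut_mulE tauE sE pi_permK.
have -> : s (phi_img _ t' h' g' (flip e' i)) = r (tau (phi_img _ t' h' g' (flip e' i))).
  by rewrite -!aut_mulE -mulgA (reflection_sq tauE) mulg1.
rewrite (reflection_phi tauE) (phi_img_comp _ _ _ _ rE).
by congr (phi_img _ _ _ _ _); case: (e'); rewrite /= ?pi_permK.
Qed.

Lemma params_coef b b' p (s : alg_aut (R b)) (s' : alg_aut (R b')) :
  has_params p s -> has_params p s' ->
  forall l m, sr_coef m (s (x_ b l)) = sr_coef m (s' (x_ b' l)).
Proof. by case: p => [[[t h] g] e] [_ sE] [_ s'E] l m; rewrite sE s'E; apply: coef_phi_img. Qed.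

Lemma coef_aut_ext b (s s' : alg_aut (R b)) :
  (forall l m, sr_coef m (s (x_ b l)) = sr_coef m (s' (x_ b l))) -> s = s'.
Proof. by move=> ss'; apply: var_coef_ext => l; apply: sr_coef_inj => m. Qed.

Lemma transfer_exists b b' : exists f : alg_aut (R b) -> alg_aut (R b'),
  forall s, exists p, has_params p s /\ has_params p (f s).
Proof.
have [|f fP] := @choice _ _ (fun (s : alg_aut (R b)) (s' : alg_aut (R b')) =>
    exists p, has_params p s /\ has_params p s'); last by exists f.
move=> s; have [p ps] := params_of s; have [s' ps'] := aut_of_params b' ps.
by exists s', p.
Qed.

Section Transfer.
Variables (b b' : bool) (f : alg_aut (R b) -> alg_aut (R b')).
Hypothesis fP : forall s, exists p, has_params p s /\ has_params p (f s).

Lemma transfer_coef s l m : sr_coef m (f s (x_ b' l)) = sr_coef m (s (x_ b l)).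
Proof. by have [p [ps pf]] := fP s; apply: params_coef pf ps _ _. Qed.

Lemma transferM s s' : f (s * s')%g = (f s * f s')%g.
Proof.
have [p [ps pf]] := fP s; have [p' [ps' pf']] := fP s'; have [p2 p2P] := params_mul p p'.
apply: coef_aut_ext => l m; rewrite transfer_coef.
exact: params_coef (p2P _ _ _ ps ps') (p2P _ _ _ pf pf') l m.
Qed.

Lemma transferV s : f (s^-1)%g = (f s)^-1%g.
Proof.
have f1 : f 1%g = 1%g by apply: (mulgI (f 1%g)); rewrite -transferM !mulg1.
by apply: (mulgI (f s)); rewrite -transferM !mulgV.
Qed.

Lemma transfer_pair_coef s c l m :
  sr_coef m (aut_pair (f s) c (x_ b' l)) = sr_coef m (aut_pair s c (x_ b l)).
Proof. by rewrite !aut_pairE; case: c; rewrite -?transferV transfer_coef. Qed.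

(** In the coordinates that define the filtration pieces, [f] is the identity. *)
Lemma transfer_morphism : ind_morphism (piece (ind_var (autX k (Delta12 b))))
  (piece (ind_var (autX k (Delta12 b')))) f.
Proof.
move=> d; exists d; apply: to_zariski => [s sd l|j].
  have sl c : sr_degree_le d (aut_pair s c (x_ b l)) by case: c; have [] := sd l.
  have fl c : sr_degree_le d (aut_pair (f s) c (x_ b' l)).
    apply/sr_degree_coef => m dm; rewrite transfer_pair_coef.
    by have /sr_degree_coef -> := sl c.
  by split; [exact: (fl true) | exact: (fl false)].
have -> : (fun s => aut_coord (f s) j) = (fun s => @aut_coord k 5 _ d s j).
  apply/funext => s; rewrite -[j]enum_valK; case: (enum_val j) => -[c l] m.
  by rewrite !aut_coord_coef transfer_pair_coef.
exact: zariski_regular.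
Qed.

End Transfer.

Lemma transferK b b' (f : alg_aut (R b) -> alg_aut (R b')) (g : alg_aut (R b') -> alg_aut (R b)) :
  (forall s, exists p, has_params p s /\ has_params p (f s)) ->
  (forall s, exists p, has_params p s /\ has_params p (g s)) -> cancel f g.
Proof.
by move=> fP gP s; apply: coef_aut_ext => l m; rewrite (transfer_coef gP) (transfer_coef fP).
Qed.

Lemma Delta_indGroup_iso b b' : indGroup_iso (autX k (Delta12 b)) (autX k (Delta12 b')).
Proof.
have [f fP] := transfer_exists b b'; have [g gP] := transfer_exists b' b.
exists f, g; split.
- exact: transferK fP gP.
- exact: transferK gP fP.
- exact: transferM fP.
- exact: transfer_morphism fP.
- exact: transfer_morphism gP.
Qed.

Lemma Delta_not_spec_iso : ~ spec_iso (sr_ring k Delta1) (sr_ring k Delta2).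
Proof.
move=> [f [g fK gK]].
have glin : linear g by move=> a x y; apply: (can_inj fK); rewrite linearP /= !gK.
have gmon : monoid_morphism g.
  by split=> [|x y]; apply: (can_inj fK); rewrite ?gK ?rmorph1 // rmorphM /= !gK.
pose G : {lrmorphism sr_ring k Delta2 -> sr_ring k Delta1} :=
  HB.pack g (GRing.isLinear.Build k _ _ _ g glin) (GRing.isMonoidMorphism.Build _ _ g gmon).
by have [] := @Delta_matching k true false f G fK gK.
Qed.

End Transport.

Theorem proposition3p18 (k : closedFieldType) (k0 : [pchar k] =i pred0) :
  [/\ (forall D : complex 5, D = Delta1 \/ D = Delta2 ->
        (forall (t : 'I_5 -> k) (h g : {poly k}), (forall i, t i != 0) ->
           exists! s : alg_aut (sr_ring k D), phi_formula t h g s) /\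
        exists tau : alg_aut (sr_ring k D),
          (forall i, tau (sr_var k D i) = sr_var k D (pi_perm i)) /\
          semidirect (@phi_set k D) (cyclic_subgroup tau)),
      indGroup_iso (autX k Delta1) (autX k Delta2),
      ~ spec_iso (sr_ring k Delta1) (sr_ring k Delta2) &
      ~ aut_determines k (fun _ _ => True)].
Proof.
have iso := Delta_indGroup_iso k true false; have niso := @Delta_not_spec_iso k.
split=> // [D Ds|det]; last by have [] := det _ _ _ _ I I iso.
have {Ds}[b ->] : exists b, D = Delta12 b by case: Ds => ->; [exists true|exists false].
split=> [t h g t0|]; last first.
  have [tau tauE] := reflection_exists k b.
  by exists tau; split=> //; apply: Delta_semidirect.
have [dom1 dom5] := Delta_dominated b.
have [s sE] := phi_exists dom1 dom5 h g t0; exists s; split=> // s'.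
by move: sE => /phi_formulaE sE /phi_formulaE s'E; apply: var_coef_ext => l; rewrite sE s'E.
Qed.
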